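(* Consider the PARID-model with initial degrees $\{W_i\}_{i\ge1}$ and parameter $\delta$. Suppose that $\mathbb{P}(W_1>x)=x^{1-\tau_W}L(x)$, where $\tau_W\in(1,2)$ and $x\mapsto L(x)$ is slowly varying at infinity. Then, for every $0<s<\tau_W-1$, there exist a constant $C>0$ and a slowly varying function $x\mapsto l(x)$ such that, for all $t\ge1$ and all $i\in\{0,\dots,t\}$, $$\mathbb{E}[d_i(t)^s]\le C\Big(\frac{t}{i\vee1}\Big)^{s/(\tau_W-1)}\Big(\frac{l(t)}{l(i)}\Big)^s,$$ where $x\vee y=\max\{x,y\}$.
   Context: PARID-model (preferential attachment with random initial degrees). Let $\{W_i\}_{i\ge1}$ be an i.i.d. sequence of positive-integer-valued random variables, with support $S_W$. Let $\delta\in\mathbb{R}$ be fixed with $\delta+\min\{x:x\in S_W\}>0$. Put $L_t=\sum_{i=1}^tW_i$. The random (multi)graph process $\{G(t)\}_{t\ge1}$ is defined as follows. $G(1)$ consists of two vertices $v_0,v_1$ with $W_1$ edges joining them. For $t\ge2$, $G(t)$ is obtained from $G(t-1)$ by adding a vertex $v_t$ and $W_t$ edges from $v_t$ to $\{v_0,\dots,v_{t-1}\}$. Conditionally on $G(t-1)$ and the initial degrees, the endpoints of these $W_t$ edges are chosen independently (with replacement), each equal to $v_i$ with probability $$\frac{d_i(t-1)+\delta}{\sum_{j=0}^{t-1}(d_j(t-1)+\delta)}=\frac{d_i(t-1)+\delta}{2L_{t-1}+t\delta},\qquad 0\le i\le t-1,$$ where $d_i(s)$ denotes the degree of $v_i$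 in $G(s)$ (edges counted with multiplicity). A slowly varying function $l$ (at infinity) satisfies $l(cx)/l(x)\to1$ as $x\to\infty$ for every $c>0$; here $l$ is taken to be defined and strictly positive on $[0,\infty)$, so that the right-hand side makes sense for $i=0$. The constant $C$ and the function $l$ do not depend on $i$ or $t$. *)

(* Defs.v *)
From HB Require Import structures.
From mathcomp Require Import all_boot all_order all_algebra.
From mathcomp Require Import all_classical all_reals all_analysis.
Import Order.TTheory GRing.Theory Num.Theory numFieldNormedType.Exports.

Set Implicit Arguments.
Unset Strict Implicit.
Unset Printing Implicit Defensive.

Local Open Scope classical_set_scope.
Local Open Scope ring_scope.

Definition slowly_varying (R : realType) (l : R -> R) : Prop :=
  forall c : R, 0 < c -> l (c * x) / l x @[x --> +oo] --> (1 : R).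

(* Mutual independence of the [X i], [i] in [I]: the product rule over every
   finite subfamily. *)
Definition mutually_independent (d : measure_display) (T : measurableType d)
    (R : realType) (P : probability T R) (d' : measure_display)
    (U : measurableType d') (I : set nat) (X : nat -> T -> U) : Prop :=
  forall (J : seq nat) (A : nat -> set U),
    uniq J -> (forall i, i \in J -> I i) -> (forall i, measurable (A i)) ->
    P (\bigcap_(i in [set` J]) X i @^-1` A i) =
    (\prod_(i <- J) P (X i @^-1` A i))%E.

Definition identically_distributed (d : measure_display)
    (T : measurableType d) (R : realType) (P : probability T R)
    (d' : measure_display) (U : measurableType d') (I : set nat)
    (X : nat -> T -> U) : Prop :=
  forall i j, I i -> I j -> forall A : set U, measurable A ->
    P (X i @^-1` A) = P (X j @^-1` A).

(* [f] is a version of the conditional probability of [A] given the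
   sigma-algebra generated by [F]. *)
Definition is_cond_prob (d : measure_display) (T : measurableType d)
    (R : realType) (P : probability T R) (F : set (set T)) (A : set T)
    (f : T -> R) : Prop :=
  measurable_fun [set: g_sigma_algebraType F]
    (f : g_sigma_algebraType F -> R) /\
  forall B, <<s F >> B -> P (A `&` B) = (\int[P]_(w in B) (f w)%:E)%E.

(* A realization of the graphs is given by the initial degrees [W t] and the
   endpoints [Y t e] (an index of an older vertex) of the edges numbered
   [e = 0, 1, ..., W t - 1] sent out by the new vertex [v_t].  The values [W 0]
   and [Y t e] for [W t <= e] play no role. *)
Section Graph.
Variables (T : Type) (W : nat -> T -> nat) (Y : nat -> nat -> T -> nat).

(* Edges of G(t), as pairs (newer endpoint, older endpoint). *)
Definition edges (t : nat) (w : T) : seq (nat * nat) :=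
  [seq (s, Y s e w) | s <- iota 1 t, e <- iota 0 (W s w)].

Definition edge_mult (t i j : nat) (w : T) : nat :=
  count (fun a => (a == (i, j)) || (a == (j, i))) (edges t w).

Definition degree (i t : nat) (w : T) : nat :=
  (count (fun a => a.1 == i) (edges t w) +
   count (fun a => a.2 == i) (edges t w))%N.

(* Generators of the sigma-algebra of G(t) (as a multigraph, i.e. its edge
   multiplicities) together with all the initial degrees. *)
Definition history (t : nat) : set (set T) :=
  [set B | (exists i j n : nat, B = edge_mult t i j @^-1` [set n]) \/
           (exists i n : nat, (1 <= i)%N /\ B = W i @^-1` [set n])].

(* Probability that an edge sent out by [v_t] is attached to [v_i]. *)
Definition attach_prob (R : realType) (delta : R) (t i : nat) (w : T) : R :=
  ((degree i t.-1 w)%:R + delta) /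
  \sum_(0 <= j < t) ((degree j t.-1 w)%:R + delta).

End Graph.

Definition init_support (d : measure_display) (T : measurableType d)
    (R : realType) (P : probability T R) (X : T -> nat) : set nat :=
  [set n | (0 < P (X @^-1` [set n]))%E].

(* For [t = 1], [parid_old] says that the [W 1] edges join [v_1] to [v_0].
   The [inf] is a minimum, the support being a nonempty set of naturals.
   In [parid_attach], the conditional joint law of the endpoints is a product,
   i.e. they are conditionally independent. *)
Record parid (d : measure_display) (T : measurableType d) (R : realType)
    (P : probability T R) (delta : R) (W : nat -> {RV P >-> nat})
    (Y : nat -> nat -> {RV P >-> nat}) : Prop := {
  parid_pos : forall i w, (1 <= i)%N -> (0 < W i w)%N ;
  parid_indep : mutually_independent P [set i | (1 <= i)%N] W ;
  parid_ident : identically_distributed P [set i | (1 <= i)%N] W ;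
  parid_delta : 0 < delta + inf [set (n%:R : R) | n in init_support P (W 1%N)] ;
  parid_old : forall t e w, (1 <= t)%N -> (e < W t w)%N -> (Y t e w < t)%N ;
  parid_attach : forall (t : nat) (x : nat -> nat), (2 <= t)%N ->
    (forall e, (x e < t)%N) ->
    is_cond_prob P (history W Y t.-1)
      [set w | forall e, (e < W t w)%N -> Y t e w = x e]
      (fun w => \prod_(0 <= e < W t w) attach_prob W Y delta t (x e) w)
}.

(* Main.v *)
Require Import Defs.
From HB Require Import structures.
From mathcomp Require Import all_boot all_order all_algebra.
From mathcomp Require Import all_classical all_reals all_analysis.
From mathcomp Require Import ring lra.
Import Order.TTheory GRing.Theory Num.Theory numFieldNormedType.Exports.
Import measurable_realfun.

(** Write alpha = tauW - 1, F x = P(W_1 > x), L_t = W_1 + ... + W_t and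
    k = max(i, 1).  Let a(t) be the least n >= 1 with t * F n <= 1; it is the
    order of magnitude of the largest of t initial degrees and, since
    alpha < 1, also that of their sum L_t.  Since F is regularly varying of
    index - alpha, a is regularly varying of index 1 / alpha, so that
    a(t) = t^(1/alpha) l(t) with l slowly varying, and the theorem reads
      E[d_i(t)^s] <= C (a(t) / a(k))^s.

    The graph enters through one fact.  Given the initial degrees, the expected
    growth of d_i + delta at time n + 1 is W_(n+1) (d_i(n) + delta) / S_n,
    where S_n = 2 L_n + (n + 1) delta is the total weight; and
    S_(n+1) >= S_n + W_(n+1).  So the share (d_i(n) + delta) / S_n is a
    supermartingale, started at (W_k + delta) / S_k when n = k, and the
    conditional mean of d_i(t) + delta is at most (W_k + delta) S_t / S_k.
    As s < 1, Jensen's inequality, used as the tangent inequality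
    [powR_tangent], turns this into [degree_moment]:
      E[d_i(t)^s] <= K E[(W_k L_t / L_k)^s].
    Conditioning means restricting to the events where W_1, ..., W_t have
    prescribed values ([init_atom]); there are countably many of them, the
    weights are constant on each, and [attach_measure] gives the law of one
    attached edge there.

    The rest concerns an i.i.d. sequence with a heavy tail ([ratio_moment]).
    Write L_t = L_k + D with D the sum of the W_j, k < j <= t.  Then
      (W_k L_t / L_k)^s <= W_k^s + W_k^s M^(- s) D^s,  M = max(1, L_(k-1)),
    and D^s is at most a(t)^s (1 + sum_j phi(W_j / a(t))) for
    phi(y) = min(y, y^s), because the power s is subadditive, which is used
    for the summands above a(t), and y^s <= 1 + y, which is used for the sum of
    the others.  W_k, M and W_j being independent ([decoupling]), three moments remain: W^s has finite mean;
    E[phi(W / b)] is O(F b), hence the sum over j contributes O(t F(a(t))), which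
    is O(1); and E[M^(- s)] is O(a(k)^(- s)), because M <= x forces k - 1
    independent variables below x, an event of probability at most
    (1 - F x)^(k-1) <= 1 / (k F x).  All three are proved by passing from x to
    2 x, using only q1 F x <= F (2 x) <= q2 F x for large x, where
    1 < 2 q1 (as alpha < 1) and 2^s q2 < 1 (as s < alpha). *)

Set Implicit Arguments.
Unset Strict Implicit.
Unset Printing Implicit Defensive.

Local Open Scope classical_set_scope.
Local Open Scope ring_scope.

(** * Functions with countable range and their integrals *)

Section Discrete.
Context (d : measure_display) (T : measurableType d).

(** All random quantities below are functions of finitely many integer-valued
    ones; asking that every preimage be measurable makes measurability stable
    under composition with arbitrary maps. *)
Definition discrete_fun (U : Type) (f : T -> U) : Prop :=
  forall A : set U, measurable (f @^-1` A).

Lemma discrete_measurable_fun (d' : measure_display) (U : measurableType d')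
  (D : set T) (f : T -> U) : discrete_fun f -> measurable_fun D f.
Proof. by move=> mf mD A _; exact: measurableI. Qed.

(** Used to get measurability from the mere fact that [f] is determined by [g],
    without exhibiting the factor map. *)
Lemma discrete_fun_factor (U V : Type) (g : T -> V) (f : T -> U) : discrete_fun g ->
  (forall w w', g w = g w' -> f w = f w') -> discrete_fun f.
Proof.
move=> mg gf A; rewrite (_ : _ @^-1` _ = g @^-1` (g @` (f @^-1` A))); first exact: mg.
apply/seteqP; split => [w|w [w' /= w'A /gf <-//]] /=; by exists w.
Qed.

Lemma discrete_comp (U V : Type) (g : T -> V) (h : V -> U) : discrete_fun g ->
  discrete_fun (fun w => h (g w)).
Proof. by move=> mg; apply: (discrete_fun_factor mg) => w w' ->. Qed.

Lemma discrete_countable (U : countType) (f : T -> U) :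
  (forall u, measurable (f @^-1` [set u])) -> discrete_fun f.
Proof.
move=> mf A; rewrite (_ : _ @^-1` _ = \bigcup_u (f @^-1` [set u] `&` (fun=> A u))).
  apply: countable_bigcupT_measurable => // u; have [Au|Au] := pselect (A u).
    by rewrite (_ : (fun=> _) = setT) ?setIT//; apply/seteqP; split.
  by rewrite (_ : (fun=> _) = set0) ?setI0//; apply/seteqP; split.
by apply/seteqP; split => [w Aw|w [u _ [/= -> ]]//]; exists (f w).
Qed.

Lemma discrete_pair (U V : countType) (f : T -> U) (g : T -> V) :
  discrete_fun f -> discrete_fun g -> discrete_fun (fun w => (f w, g w)).
Proof.
move=> mf mg; apply: discrete_countable => -[u v].
rewrite (_ : _ @^-1` _ = f @^-1` [set u] `&` g @^-1` [set v]); first exact: measurableI.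
by apply/seteqP; split => w /= [-> ->].
Qed.

Lemma discrete_seq (I : Type) (U : countType) (f : I -> T -> U) (s : seq I) :
  (forall i, discrete_fun (f i)) -> discrete_fun (fun w => [seq f i w | i <- s]).
Proof.
move=> mf; elim: s => [|i s IH] /=.
  by move=> A; have [?|?] := pselect (A [::]);
    [rewrite (_ : _ @^-1` _ = setT)|rewrite (_ : _ @^-1` _ = set0)] => //; apply/seteqP; split.
by apply: (discrete_fun_factor (discrete_pair (mf i) IH)) => w w' [-> ->].
Qed.

(** For sums or sequences whose length is itself random, such as the W_t
    endpoints of the edges of the t-th vertex. *)
Lemma discrete_glue (U : Type) (V : countType) (g : T -> V) (f : V -> T -> U) :
  discrete_fun g -> (forall v, discrete_fun (f v)) ->
  discrete_fun (fun w => f (g w) w).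
Proof.
move=> mg mf A.
rewrite (_ : _ @^-1` _ = \bigcup_v (g @^-1` [set v] `&` f v @^-1` A)).
  apply: countable_bigcupT_measurable => // v.
  by apply: measurableI; [exact: mg|exact: mf].
apply/seteqP; split => [w Aw|w [v _ [/= -> //]]].
by exists (g w).
Qed.

End Discrete.

Section Integral.
Context (d : measure_display) (T : measurableType d) (R : realType).
Variable P : probability T R.
Implicit Types (D E : set T) (f g : T -> R).

Lemma measurable_EFin_discrete D f : discrete_fun f -> measurable_fun D (EFin \o f).
Proof. by move=> mf; apply: discrete_measurable_fun; exact: discrete_comp. Qed.

Lemma integral_le_cst D f k p : measurable D -> discrete_fun f ->
  (forall w, D w -> 0 <= f w <= k) -> 0 <= k -> (P D <= p%:E)%E ->
  (\int[P]_(w in D) (f w)%:E <= (k * p)%:E)%E.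
Proof.
move=> mD mf fk k0 Pp.
apply: (@le_trans _ _ (\int[P]_(w in D) cst k%:E w)%E).
  apply: ge0_le_integral => //; first by move=> w /fk /andP[]; rewrite lee_fin.
  - exact: measurable_EFin_discrete.
  - by move=> w /fk /andP[]; rewrite lee_fin.
by rewrite integral_cst// EFinM lee_wpmul2l ?lee_fin.
Qed.

Lemma integral_split D E f : measurable D -> measurable E -> discrete_fun f ->
  (forall w, D w -> 0 <= f w) ->
  (\int[P]_(w in D) (f w)%:E =
  \int[P]_(w in D `&` E) (f w)%:E + \int[P]_(w in D `\` E) (f w)%:E)%E.
Proof.
move=> mD mE mf f0; rewrite -[in LHS](setUIDK D E) ge0_integral_setU//.
- exact: measurableI.
- exact: measurableD.
- exact: measurable_EFin_discrete.
- by move=> w; rewrite setUIDK => /f0; rewrite lee_fin.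
- by apply/disj_setPS => w [[_ Ew] [_]].
Qed.

Lemma integral_le_split D E f (r s t : R) : measurable D -> measurable E ->
  discrete_fun f -> (forall w, D w -> 0 <= f w) ->
  (\int[P]_(w in D `&` E) (f w)%:E <= r%:E)%E ->
  (\int[P]_(w in D `\` E) (f w)%:E <= s%:E)%E -> r + s <= t ->
  (\int[P]_(w in D) (f w)%:E <= t%:E)%E.
Proof.
move=> mD mE mf f0 h1 h2 rs; rewrite (integral_split mD mE)//.
by apply: (@le_trans _ _ (r + s)%:E); rewrite ?lee_fin// EFinD leeD.
Qed.

Lemma integral_leM D f g k r : measurable D -> discrete_fun f -> discrete_fun g ->
  (forall w, D w -> 0 <= f w <= k * g w) -> (forall w, D w -> 0 <= g w) -> 0 <= k ->
  (\int[P]_(w in D) (g w)%:E <= r%:E)%E ->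
  (\int[P]_(w in D) (f w)%:E <= (k * r)%:E)%E.
Proof.
move=> mD mf mg fg g0 k0 H.
apply: (@le_trans _ _ (\int[P]_(w in D) (k%:E * (g w)%:E))%E).
  apply: ge0_le_integral => //; first by move=> w /fg /andP[]; rewrite lee_fin.
  - exact: measurable_EFin_discrete.
  - under eq_fun do rewrite -EFinM; apply: measurable_EFin_discrete.
    exact: (discrete_comp ( *%R k)).
  - by move=> w /fg /andP[]; rewrite -EFinM lee_fin.
rewrite ge0_integralZl_EFin//; last exact: measurable_EFin_discrete.
by rewrite EFinM lee_wpmul2l ?lee_fin.
Qed.

End Integral.

Lemma measurable_discrete_pred (d : measure_display)
  (T : measurableType d) (U : Type) (V : T -> U) (p : U -> bool) :
  discrete_fun V -> measurable [set w | p (V w)].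
Proof. by move=> mV; exact: (mV [set u | p u]). Qed.

Lemma sume_const (R : realType) (I : Type) (s : seq I) (x : \bar R) :
  (\sum_(i <- s) x = (size s)%:R%:E * x)%E.
Proof.
elim: s => [|i s IH]; first by rewrite big_nil mul0e.
rewrite big_cons IH /= -natr1 EFinD ge0_muleDl ?lee_fin// mul1e addeC.
by [].
Qed.

(** A one-sided form of independence: if [g] has average at most [c] on each level
    set of [X], then [c] comes out of the expectation of [u (X) * g].  The law of
    [g] need not be known, which allows variables to be split off one by one. *)
Lemma integral_comp_le (d : measure_display) (T : measurableType d) (R : realType)
  (P : probability T R) (D : set T) (X : T -> nat) (u : nat -> R) (g : T -> R) (c : R) :
  measurable D -> discrete_fun X -> discrete_fun g ->
  (forall n, 0 <= u n) -> (forall w, 0 <= g w) -> 0 <= c ->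
  (forall n, (\int[P]_(w in D `&` X @^-1` [set n]) (g w)%:E <= c%:E * P (X @^-1` [set n]))%E) ->
  (\int[P]_(w in D) (u (X w) * g w)%:E <= c%:E * \int[P]_w (u (X w))%:E)%E.
Proof.
move=> mD mX mg u0 g0 c0 H.
pose F n := D `&` X @^-1` [set n]; pose G n := X @^-1` [set n].
have mu (h : nat -> R) : discrete_fun (fun w => h (X w)) by exact: discrete_comp.
have mF n : measurable (F n) by apply: measurableI => //; exact: mX.
have mG n : measurable (G n) by exact: mX.
have tG : trivIset setT G.
  apply/trivIsetP => m n _ _ /eqP mn; apply/seteqP; split => // w [/= e1 e2].
  by apply: mn; rewrite -e1 -e2.
have tF : trivIset setT F.
  apply/trivIsetP => m n _ _ /eqP mn; apply/seteqP; split => // w [[_ /= e1] [_ /= e2]].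
  by apply: mn; rewrite -e1 -e2.
have UG : \bigcup_n G n = setT by apply/seteqP; split => // w _; exists (X w).
have UF : \bigcup_n F n = D.
  by apply/seteqP; split => [w [n _ []//]|w Dw]; exists (X w).
have mug : discrete_fun (fun w => u (X w) * g w).
  exact: (discrete_glue (f := fun v w => u v * g w) mX
    (fun v => discrete_comp ( *%R (u v)) mg)).
rewrite -ge0_integralZl_EFin//; first last.
- by apply: measurable_EFin_discrete.
- by move=> w _; rewrite lee_fin.
rewrite -{1}UF -UG !ge0_integral_bigcup//; first last.
- by move=> w _; rewrite lee_fin mulr_ge0.
- by rewrite UF; apply: measurable_EFin_discrete.
- by move=> w _; rewrite mule_ge0// lee_fin.
- rewrite UG; under eq_fun do rewrite -EFinM.
  by apply: measurable_EFin_discrete; exact: (mu (fun n => c * u n)).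
apply: lee_nneseries => [n _|n _].
  by move=> _; apply: integral_ge0 => w _; rewrite lee_fin mulr_ge0.
have -> : (\int[P]_(w in F n) (u (X w) * g w)%:E = (u n)%:E * \int[P]_(w in F n) (g w)%:E)%E.
  rewrite -ge0_integralZl_EFin//; last 2 first.
  - by move=> w _; rewrite lee_fin.
  - exact: measurable_EFin_discrete.
  by apply: eq_integral => w; rewrite inE => -[_ /= ->]; rewrite EFinM.
have -> : (\int[P]_(w in G n) (c%:E * (u (X w))%:E) = (u n)%:E * (c%:E * P (G n)))%E.
  rewrite (eq_integral (cst (u n * c)%:E)); last first.
    by move=> w; rewrite inE => /= ->; rewrite -EFinM mulrC.
  by rewrite integral_cst// EFinM muleA.
by rewrite lee_wpmul2l ?lee_fin//; exact: H.
Qed.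

(** * Inequalities for real powers *)

Lemma one_powR (R : realType) (s : R) : (1 : R) `^ s = 1.
Proof. by rewrite powR1. Qed.

Lemma powR_le (R : realType) (p a b : R) : 0 <= p -> 0 <= a -> a <= b ->
  a `^ p <= b `^ p.
Proof.
move=> p0 a0 ab; apply: ge0_ler_powR; rewrite ?nnegrE//.
exact: le_trans ab.
Qed.

Lemma powRN_le (R : realType) (p a b : R) : 0 <= p -> 0 < a -> a <= b ->
  b `^ (- p) <= a `^ (- p).
Proof.
move=> p0 a0 ab; rewrite !powRN lef_pV2 ?posrE ?powR_gt0//.
  by rewrite powR_le// ltW.
exact: lt_le_trans ab.
Qed.

Lemma powRV (R : realType) (p x : R) : 0 <= x -> x^-1 `^ p = (x `^ p)^-1.
Proof. by move=> x0; rewrite -powR_inv1// powRAC powR_inv1// powR_ge0. Qed.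

Lemma powR_div (R : realType) (p x y : R) : 0 <= x -> 0 <= y ->
  (x / y) `^ p = x `^ p / y `^ p.
Proof. by move=> x0 y0; rewrite powRM ?invr_ge0// powRV. Qed.

(** The graph of the concave function [y `^ s] lies below its tangent at [z].
    The right-hand side is linear in [y], so it only needs a first moment of [y],
    and it equals [z `^ s] when that moment is [z]. *)
Lemma powR_tangent (R : realType) (s y z : R) : 0 < s < 1 -> 0 <= y -> 0 < z ->
  y `^ s <= (1 - s) * z `^ s + s * z `^ (s - 1) * y.
Proof.
move=> /andP[s0 s1] y0 z0; have s1' : 0 < 1 - s by rewrite subr_gt0.
have := @conjugate_powR _ (y `^ s) (z `^ (1 - s)) s^-1 (1 - s)^-1.
rewrite !powR_ge0 !invr_gt0 s0 s1' !invrK -!powRrM !mulfV ?gt_eqF// !powRr1 ?(ltW z0)//.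
rewrite addrC subrK => /(_ isT isT isT isT erefl) h.
have zz : z `^ (1 - s) * z `^ (s - 1) = 1.
  rewrite -powRD; last by rewrite (gt_eqF z0) implybT.
  by rewrite (_ : 1 - s + _ = 0) ?powRr0//; ring.
have : y `^ s * z `^ (1 - s) * z `^ (s - 1) <= (y * s + z * (1 - s)) * z `^ (s - 1).
  by rewrite ler_wpM2r ?powR_ge0.
rewrite -mulrA zz mulr1 => /le_trans; apply.
rewrite -[in leRHS](mulr_powRB1 (ltW z0) s0) le_eqVlt; apply/orP; left; apply/eqP; ring.
Qed.

Lemma powR_subadd (R : realType) (s x y : R) : 0 < s <= 1 -> 0 <= x -> 0 <= y ->
  (x + y) `^ s <= x `^ s + y `^ s.
Proof.
move=> /andP[s0 s1] x0 y0; have := addr_ge0 x0 y0.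
rewrite le_eqVlt => /predU1P[<-|xy0].
  by rewrite powR0 ?gt_eqF// addr_ge0 ?powR_ge0.
have part u : 0 <= u -> u <= x + y -> (x + y) `^ s * (u / (x + y)) <= u `^ s.
  move=> u0 uxy; have r0 : 0 <= u / (x + y) by rewrite divr_ge0// ltW.
  have -> : u `^ s = (x + y) `^ s * (u / (x + y)) `^ s.
    by rewrite -powRM// ?(ltW xy0)// mulrC divfK// gt_eqF.
  rewrite ler_wpM2l ?powR_ge0//.
  move: r0; rewrite le_eqVlt => /predU1P[<-|r0]; first by rewrite powR0 ?gt_eqF.
  by rewrite ger1_powR// r0 ler_pdivrMr// mul1r.
have -> : (x + y) `^ s = (x + y) `^ s * (x / (x + y)) + (x + y) `^ s * (y / (x + y)).
  by rewrite -mulrDr -mulrDl divff ?gt_eqF// mulr1.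
by rewrite lerD// part// ?lerDl ?lerDr.
Qed.

Lemma powR_sum_le (R : realType) (s : R) (I : Type) (r : seq I) (Q : pred I) (f : I -> R) :
  0 < s <= 1 -> (forall i, 0 <= f i) ->
  (\sum_(i <- r | Q i) f i) `^ s <= \sum_(i <- r | Q i) f i `^ s.
Proof.
move=> s01 f0; have /andP[s0 _] := s01.
elim: r => [|i r IH]; first by rewrite !big_nil powR0 ?gt_eqF.
rewrite !big_cons; case: ifP => // _.
by rewrite (le_trans (powR_subadd s01 _ _))// ?sumr_ge0// lerD2l.
Qed.

(** The cost of one summand in an [s]-th moment of a sum: a summand below the
    typical size of the sum counts linearly, a larger one through its power. *)
Definition trunc_pow (R : realType) (s y : R) : R := Num.min y (y `^ s).

Lemma trunc_pow_ge0 (R : realType) (s y : R) : 0 <= y -> 0 <= trunc_pow s y.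
Proof. by move=> y0; rewrite le_min y0 powR_ge0. Qed.

Lemma trunc_pow_scale (R : realType) (s k y : R) : s < 1 -> 1 <= k -> 0 <= y ->
  trunc_pow s (k * y) <= k * trunc_pow s y.
Proof.
move=> s1 k1 y0; have k0 : 0 <= k by apply: le_trans k1.
rewrite /trunc_pow minr_pMr//.
rewrite le_min !ge_min lexx/= powRM//; apply/orP; right.
by rewrite ler_wpM2r ?powR_ge0// ler1_powR// ltW.
Qed.

(** Separate the terms below and above 1: [x `^ s <= 1 + x] for the sum of the
    former, subadditivity of the power for the latter. *)
Lemma powR_sum_trunc (R : realType) (s : R) (I : Type) (r : seq I) (f : I -> R) :
  0 < s <= 1 -> (forall i, 0 <= f i) ->
  (\sum_(i <- r) f i) `^ s <= 1 + \sum_(i <- r) trunc_pow s (f i).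
Proof.
move=> s01 f0; have /andP[s0 s1] := s01.
rewrite (bigID (fun i => f i <= 1)) /= [in leRHS](bigID (fun i => f i <= 1)) /=.
rewrite (le_trans (powR_subadd s01 _ _)) ?sumr_ge0// addrA lerD//; last first.
  apply: (le_trans (powR_sum_le _ _ s01 f0)); apply: ler_sum => i; rewrite -ltNge => fi.
  by rewrite /trunc_pow le_min lexx andbT ler1_powR// ltW.
set A := \sum_(i <- r | _) f i.
have A0 : 0 <= A by apply: sumr_ge0.
apply: (@le_trans _ _ (1 + A)).
  have [A1|A1] := leP A 1.
    by rewrite (@le_trans _ _ 1) ?lerDl// -[leRHS](one_powR s) powR_le// ltW.
  by rewrite (@le_trans _ _ A) ?lerDr// ler1_powR// ltW.
rewrite lerD2l; apply: ler_sum => i fi.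
rewrite /trunc_pow le_min lexx/=; have := f0 i; rewrite le_eqVlt => /predU1P[<-|f0i].
  exact: powR_ge0.
by rewrite ger1_powR// f0i.
Qed.

(** Bernoulli: (1 - f)^n (1 + n f) <= 1, and (n + 1) f <= 1 + n f. *)
Lemma bernoulli_inv (R : realType) (f : R) (n : nat) : 0 < f <= 1 ->
  (1 - f) ^+ n <= (n.+1%:R * f)^-1.
Proof.
move=> /andP[f0 f1].
have H m : (1 - f) ^+ m * (1 + m%:R * f) <= 1.
  elim: m => [|m IH]; first by rewrite expr0 mul0r addr0 mulr1.
  have p0 : 0 <= (1 - f) ^+ m by rewrite exprn_ge0// subr_ge0.
  rewrite exprS (le_trans _ IH)// mulrAC mulrC ler_wpM2l// -natr1.
  have m0 : (0 : R) <= m%:R by rewrite ler0n.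
  have := mulr_ge0 m0 (mulr_ge0 (ltW f0) (ltW f0)).
  by have := mulr_ge0 (ltW f0) (ltW f0); nra.
have nf : 0 < n.+1%:R * f by rewrite mulr_gt0.
rewrite -[leRHS]mul1r ler_pdivlMr// (le_trans _ (H n))// ler_wpM2l//.
  by rewrite exprn_ge0// subr_ge0.
by rewrite -natr1 mulrDl mul1r addrC lerD2r.
Qed.

(** * Regular variation and the tail quantile *)

Section RegularVariation.
Variable R : realType.
Implicit Types (F : R -> R) (x y t c alpha s : R).

Definition regularly_varying F alpha : Prop :=
  forall c, 0 < c -> F (c * x) / F x @[x --> +oo] --> c `^ (- alpha).

Lemma regularly_varying_le F alpha c b :
  (forall x, 0 <= x -> 0 < F x) -> regularly_varying F alpha ->
  0 < c -> c `^ (- alpha) < b ->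
  exists2 x0, 0 <= x0 & forall x, x0 <= x -> F (c * x) <= b * F x.
Proof.
move=> F0 rvF c0 cb.
have [M [_ HM]] := cvgr_lt _ (rvF c c0) b cb.
exists (`|M| + 1) => [|x xM]; first by rewrite addr_ge0.
have Mx : M < x by rewrite (le_lt_trans (ler_norm _))// (lt_le_trans _ xM)// ltrDl.
have x0 : 0 <= x by rewrite (le_trans _ xM)// addr_ge0.
by have := HM x Mx; rewrite /= ltr_pdivrMr ?F0// => /ltW.
Qed.

Lemma regularly_varying_ge F alpha c b :
  (forall x, 0 <= x -> 0 < F x) -> regularly_varying F alpha ->
  0 < c -> b < c `^ (- alpha) ->
  exists2 x0, 0 <= x0 & forall x, x0 <= x -> b * F x <= F (c * x).
Proof.
move=> F0 rvF c0 cb.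
have [M [_ HM]] := cvgr_gt _ (rvF c c0) b cb.
exists (`|M| + 1) => [|x xM]; first by rewrite addr_ge0.
have Mx : M < x by rewrite (le_lt_trans (ler_norm _))// (lt_le_trans _ xM)// ltrDl.
have x0 : 0 <= x by rewrite (le_trans _ xM)// addr_ge0.
by have := HM x Mx; rewrite /= ltr_pdivlMr ?F0// => /ltW.
Qed.

(** The limit 2^(- alpha) of F (2 x) / F x lies strictly between 1/2 and 2^(- s);
    [q1] and [q2] are the midpoints on either side of it. *)
Lemma regularly_varying_doubling F alpha s :
  (forall x, 0 <= x -> 0 < F x) -> regularly_varying F alpha ->
  0 < s < alpha -> alpha < 1 ->
  exists x0 q1 q2, [/\ 1 <= x0, 1 < 2 * q1, 2 `^ s * q2 < 1 &
    forall x, x0 <= x -> q1 * F x <= F (2 * x) <= q2 * F x].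
Proof.
move=> F0 rvF /andP[s0 sa] a1.
have half_lt : 2^-1 < (2:R) `^ (- alpha).
  rewrite -powR_inv1// lt_neqAle ler_powR ?ler1n// ?lerN2 ?(ltW a1)// andbT.
  apply/eqP => /(congr1 (fun z => ln z)); rewrite !ln_powR => /eqP.
  rewrite -subr_eq0 -mulrBl mulf_eq0 lt_eqF ?subr_lt0//=; last by lra.
  by rewrite gt_eqF// ln_gt0// ltr1n.
have lt2 : (2:R) `^ (- alpha) < 2 `^ (- s).
  rewrite lt_neqAle ler_powR ?ler1n// ?lerN2 ?(ltW sa)// andbT.
  apply/eqP => /(congr1 (fun z => ln z)); rewrite !ln_powR => /eqP.
  rewrite -subr_eq0 -mulrBl mulf_eq0 lt_eqF ?subr_lt0//=; last by lra.
  by rewrite gt_eqF// ln_gt0// ltr1n.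
have [h1 h2] := midf_lt half_lt; have [h3 h4] := midf_lt lt2.
have [x1 x10 H1] := regularly_varying_ge F0 rvF (ltr0Sn R 1) h2.
have [x2 x20 H2] := regularly_varying_le F0 rvF (ltr0Sn R 1) h3.
exists (1 + x1 + x2), ((2^-1 + 2 `^ (- alpha)) / 2), ((2 `^ (- alpha) + 2 `^ (- s)) / 2).
split.
- lra.
- by rewrite -(ltr_pM2l (ltr0Sn R 1)) mulfV in h1.
- have := h4; rewrite -(ltr_pM2l (powR_gt0 s (ltr0Sn R 1))).
  by rewrite -[X in _ < X]powRD ?subrr ?powRr0//; rewrite pnatr_eq0 implybT.
- by move=> x xx; apply/andP; split; [apply: H1; lra|apply: H2; lra].
Qed.

(** [a t] is the least integer [n >= 1] with [t * F n <= 1], a quantile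
    of order 1 - 1/t for the law with tail [F].  The last clause compares with
    real [y], as is possible for a tail that is constant between integers. *)
Definition tail_quantile F (a : R -> nat) : Prop := forall t, 0 < t ->
  [/\ (1 <= a t)%N, t * F (a t)%:R <= 1 &
      forall y, 1 <= y -> t * F y <= 1 -> (a t)%:R <= y].

Section Quantile.
Variables (F : R -> R) (alpha : R).
Hypotheses (Fpos : forall x : R, 0 <= x -> 0 < F x)
  (Fmono : forall x y : R, 0 <= x -> x <= y -> F y <= F x)
  (Ftrunc : forall x : R, 0 <= x -> F x = F (Num.truncn x)%:R)
  (rvF : regularly_varying F alpha).

Lemma vanishing_regularly_varying : 0 < alpha ->
  forall b, 0 < b -> exists n : nat, F n%:R <= b.
Proof.
move=> a0 b b0.
have lt1 : (2:R) `^ (- alpha) < 1.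
  rewrite powRN invf_lt1 ?powR_gt0// -[ltLHS](one_powR alpha).
  by apply: gt0_ltr_powR; rewrite ?nnegrE ?ltr1n.
have [h1 h2] := midf_lt lt1; set q := (_ / 2) in h1 h2.
have q0 : 0 <= q by rewrite /q divr_ge0// addr_ge0// powR_ge0.
have [x0 x00 H] := regularly_varying_le Fpos rvF (ltr0Sn R 1) h1.
have Hn n : F (2 ^+ n * x0) <= q ^+ n * F x0.
  elim: n => [|n IH]; first by rewrite !expr0 !mul1r.
  rewrite exprS -mulrA (le_trans (H _ _))//.
    by rewrite ler_peMl// exprn_ege1// ler1n.
  by rewrite exprS -mulrA ler_wpM2l.
have : (q ^+ n * F x0) @[n --> \oo] --> (0 * F x0 : R).
  by apply: cvgM; [apply: cvg_expr; rewrite ger0_norm|exact: cvg_cst].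
rewrite mul0r => /cvgr_lt /(_ b b0)[n _ /(_ n (leqnn _))/= nb].
exists (Num.bound (2 ^+ n * x0)); apply: le_trans (ltW nb); apply: le_trans (Hn n).
by apply: Fmono; rewrite ?mulr_ge0 ?exprn_ge0// ltW// archi_boundP ?mulr_ge0 ?exprn_ge0.
Qed.

Lemma exists_tail_quantile : 0 < alpha -> exists a, tail_quantile F a.
Proof.
move=> a0.
suff : forall t, exists n : nat, 0 < t ->
    [/\ (1 <= n)%N, t * F n%:R <= 1 &
      forall y, 1 <= y -> t * F y <= 1 -> n%:R <= y].
  by move/choice => [a Ha]; exists a.
move=> t; have [t0|t0] := ltP 0 t; last by exists 0%N.
have ex : exists n, (1 <= n)%N && (t * F n%:R <= 1).
  have [|n nt] := vanishing_regularly_varying a0 (b := t^-1); first by rewrite invr_gt0.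
  exists n.+1; rewrite /= mulrC -ler_pdivlMr// div1r (le_trans _ nt)//.
  by rewrite Fmono// ler_nat.
exists (ex_minn ex) => _; case: ex_minnP => n /andP[n1 nt] nmin; split=> // y y1 yt.
have y0 : 0 <= y by rewrite (le_trans _ y1).
rewrite Ftrunc// in yt; have := y0; rewrite -truncn_le; apply: le_trans; rewrite ler_nat.
by apply: nmin; rewrite yt andbT; rewrite truncn_gt0.
Qed.

Variable a : R -> nat.
Hypothesis Ha : tail_quantile F a.

Lemma tail_quantile_homo t t' : 0 < t -> t <= t' -> (a t <= a t')%N.
Proof.
move=> t0 tt'; have t'0 : 0 < t' by apply: lt_le_trans tt'.
have [_ _ H] := Ha t0; have [a1 H1 _] := Ha t'0.
by rewrite -(ler_nat R) H ?ler1n// (le_trans _ H1)// ler_wpM2r// ltW// Fpos.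
Qed.

Lemma tail_quantile_unbounded (M : R) : exists2 t0 : R, 0 < t0 &
  forall t, t0 <= t -> M <= (a t)%:R.
Proof.
have [M0|M0] := leP M 0; first by exists 1 => // t _; rewrite (le_trans M0).
have FM := Fpos (ltW M0); exists (2 / F M) => [|t tt]; first by rewrite divr_gt0.
have t0 : 0 < t by rewrite (lt_le_trans _ tt)// divr_gt0.
rewrite leNgt; apply/negP => aM; have [_ H _] := Ha t0.
have : t * F M <= 1.
  by rewrite (le_trans _ H)// ler_wpM2l ?(ltW t0)// Fmono// ltW.
by apply/negP; rewrite -ltNge; move: tt; rewrite ler_pdivrMr//; lra.
Qed.

(** With [lam = eta * c^(1/alpha)], F (lam x) is eventually below F x / c; at
    [x = a t] this makes [lam * a t] a competitor in the minimum defining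
    [a (c * t)].  The reverse bound is the same statement for [c^-1]. *)
Lemma tail_quantile_asymp (c eta : R) : 0 < alpha -> 0 < c -> 1 < eta ->
  exists2 t0 : R, 0 < t0 & forall t, t0 <= t ->
    (a (c * t))%:R <= eta * c `^ (alpha^-1) * (a t)%:R.
Proof.
move=> a0 c0 eta1; set lam := eta * _.
have eta0 : 0 < eta by lra.
have lam0 : 0 < lam by rewrite mulr_gt0 ?powR_gt0.
have lamc : lam `^ (- alpha) < c^-1.
  rewrite powRN ltf_pV2 ?posrE ?powR_gt0//.
  rewrite powRM ?powR_ge0 ?(ltW eta0)// -powRrM mulVf ?gt_eqF// powRr1 ?(ltW c0)//.
  rewrite ltr_pMl// -[ltLHS](one_powR alpha).
  by apply: gt0_ltr_powR; rewrite ?nnegrE// ltW.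
have [x0 x00 H] := regularly_varying_le Fpos rvF lam0 lamc.
have [t0 t00 Ht0] := tail_quantile_unbounded (x0 + lam^-1).
exists t0 => // t tt; have t0' : 0 < t by apply: lt_le_trans tt.
have lam'0 : 0 < lam^-1 by rewrite invr_gt0.
have at_ := Ht0 t tt; have [_ Hat _] := Ha t0'.
have [|_ _] := Ha (_ : 0 < c * t); first exact: mulr_gt0.
apply.
  by rewrite mulrC -ler_pdivrMr// div1r; lra.
have : F (lam * (a t)%:R) <= c^-1 * F (a t)%:R by apply: H; lra.
rewrite -(ler_pM2l c0) mulVKf ?gt_eqF// -(ler_pM2l t0') => h.
by rewrite -mulrA mulrCA (le_trans h).
Qed.

(** The cut-off at 1 makes this positive on the whole half-line, with the same
    value at 0 and at 1. *)
Definition quantile_slow_part x : R :=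
  (a (Num.max x 1))%:R / (Num.max x 1) `^ alpha^-1.

Lemma quantile_slow_part_gt0 x : 0 < quantile_slow_part x.
Proof.
have x1 : 0 < Num.max x 1 by rewrite lt_max ltr01 orbT.
by have [a1 _ _] := Ha x1; rewrite divr_gt0 ?powR_gt0// ltr0n.
Qed.

Lemma quantile_slow_partE x : 1 <= x ->
  (a x)%:R = x `^ alpha^-1 * quantile_slow_part x.
Proof.
move=> x1; rewrite /quantile_slow_part (max_idPl x1) mulrC divfK//.
by rewrite powR_eq0 gt_eqF// (lt_le_trans _ x1).
Qed.

Lemma slowly_varying_quantile : 0 < alpha -> slowly_varying quantile_slow_part.
Proof.
move=> a0 c c0; apply/cvgrPdist_le => e e0.
have eta1 : 1 < 1 + e by rewrite ltrDl.
have ci0 : 0 < c^-1 by rewrite invr_gt0.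
have [t1 t10 H1] := tail_quantile_asymp a0 c0 eta1.
have [t2 t20 H2] := tail_quantile_asymp a0 ci0 eta1.
exists (1 + c^-1 + t1 + t2 / c); split => [|t tt]; first by rewrite num_real.
have t2c : 0 < t2 / c by rewrite divr_gt0.
have t_1 : 1 <= t by lra.
have ct_1 : 1 <= c * t by rewrite mulrC -ler_pdivrMr// div1r; lra.
have t0 : 0 < t by lra.
have {H1} := H1 t; rewrite !quantile_slow_partE// => H1.
have {H2} := H2 (c * t); rewrite mulKf ?gt_eqF// !quantile_slow_partE// => H2.
set lt := quantile_slow_part t in H1 H2 *.
set lct := quantile_slow_part (c * t) in H1 H2 *.
have lt0 : 0 < lt by exact: quantile_slow_part_gt0.
have lct0 : 0 < lct by exact: quantile_slow_part_gt0.
have pt0 : 0 < t `^ alpha^-1 by rewrite powR_gt0.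
have pc0 : 0 < c `^ alpha^-1 by rewrite powR_gt0.
have {}H1 : lct <= (1 + e) * lt.
  have := H1 _; rewrite powRM ?(ltW c0) ?(ltW t0)// => h.
  have : c `^ alpha^-1 * t `^ alpha^-1 * lct <= c `^ alpha^-1 * t `^ alpha^-1 * ((1 + e) * lt).
    apply: le_trans (h _) _; [lra|rewrite le_eqVlt; apply/orP; left; apply/eqP; ring].
  by rewrite ler_pM2l// mulr_gt0.
have {}H2 : lt <= (1 + e) * lct.
  have := H2 _; rewrite powRM ?(ltW c0) ?(ltW t0)// -(powR_inv1 (ltW c0)).
  rewrite powRAC powR_inv1 ?powR_ge0// => h.
  have : t `^ alpha^-1 * lt <= t `^ alpha^-1 * ((1 + e) * lct).
    apply: le_trans (h _) _.
      by rewrite mulrC -ler_pdivrMr//; have : 0 < c^-1 by []; lra.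
    rewrite le_eqVlt; apply/orP; left; apply/eqP; field; by rewrite gt_eqF.
  by rewrite ler_pM2l.
rewrite ler_distlC; apply/andP; split.
  rewrite ler_pdivlMr//; nra.
by rewrite ler_pdivrMr.
Qed.

End Quantile.
End RegularVariation.

(** * Moments of a regularly varying tail *)

Section Moments.
Context (d : measure_display) (T : measurableType d) (R : realType).
Variable P : probability T R.
Variables (F : R -> R) (s x0 q1 q2 : R).
Hypotheses (Fpos : forall x : R, 0 <= x -> 0 < F x)
  (Fmono : forall x y : R, 0 <= x -> x <= y -> F y <= F x)
  (s0 : 0 < s) (s1 : s < 1) (x01 : 1 <= x0) (q1h : 1 < 2 * q1)
  (q2h : 2 `^ s * q2 < 1)
  (doubling : forall x : R, x0 <= x -> q1 * F x <= F (2 * x) <= q2 * F x).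

Let x00 : 0 < x0. Proof. exact: lt_le_trans x01. Qed.

Definition has_tail (V : T -> nat) : Prop :=
  discrete_fun V /\ forall x : R, 0 <= x -> P [set w | x < (V w)%:R] = (F x)%:E.

Lemma dyadic_induction (Q : R -> Prop) :
  (forall x, x0 <= x <= 2 * x0 -> Q x) ->
  (forall x, x0 <= x -> Q x -> Q (2 * x)) -> forall x, x0 <= x -> Q x.
Proof.
move=> Q0 QS x x0x.
have [n] : exists n : nat, x <= 2 ^+ n * x0.
  exists (Num.bound x); rewrite (@le_trans _ _ (2 ^+ (Num.bound x)))//.
    rewrite (le_trans (ltW (archi_boundP _)))//; first by rewrite (le_trans (ltW x00)).
    by rewrite -natrX ler_nat ltnW// ltn_expl.
  by rewrite ler_peMr// exprn_ge0.
elim: n x x0x => [|n IH] x x0x xn.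
  by apply: Q0; rewrite x0x/= (le_trans xn)// expr0 mul1r; have := x00; lra.
have [xle|xgt] := leP x (2 * x0); first by apply: Q0; rewrite x0x.
have -> : x = 2 * (x / 2) by field.
apply: QS; first by lra.
by apply: IH; [lra|rewrite ler_pdivrMr// mulrC mulrA -exprS].
Qed.

(** Karamata: for a tail of index above - 1 the truncated mean at [x] is of the
    order of its last dyadic block.  From [x] to [2 * x] the integral grows by at
    most [2 * x * F x], while [x * F x] is multiplied by at least [2 * q1 > 1]. *)
Lemma truncated_mean : exists2 K, 0 < K & forall V, has_tail V ->
  forall x : R, x0 <= x ->
  (\int[P]_(w in [set w | ((V w)%:R <= x)%R]) ((V w)%:R)%:E <= (K * (x * F x))%:E)%E.
Proof.
have F0 := Fpos (mulr_ge0 (ler0n R 2) (ltW x00)).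
have q1' : 0 < 2 * q1 - 1 by rewrite subr_gt0.
(* the first summand handles x <= 2 * x0, the second makes K + 2 <= 2 * q1 * K *)
set K := (F (2 * x0))^-1 + 2 / (2 * q1 - 1).
have K0 : 0 < K by rewrite addr_gt0// ?divr_gt0// invr_gt0.
exists K => // V [mV tV]; have mVR : discrete_fun (fun w => (V w)%:R : R).
  exact: (discrete_comp (fun n : nat => n%:R : R)).
have mle (y : R) : measurable [set w | ((V w)%:R <= y)%R].
  exact: (measurable_discrete_pred (fun u : R => u <= y) mVR).
have mgt (y : R) : measurable [set w | (y < (V w)%:R)%R].
  exact: (measurable_discrete_pred (fun u : R => y < u) mVR).
apply: dyadic_induction => x.
  move=> /andP[xx0 x2]; have x_0 : 0 < x by apply: lt_le_trans xx0.
  apply: (@le_trans _ _ (x * 1)%:E).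
    apply: integral_le_cst => //; last exact: probability_le1.
    - by move=> w /= ->; rewrite ler0n.
    - exact: ltW.
  rewrite lee_fin mulrCA ler_pM2l//.
  apply: (@le_trans _ _ ((F (2 * x0))^-1 * F (2 * x0))); first by rewrite mulVf// gt_eqF.
  apply: ler_pM; rewrite ?invr_ge0 ?(ltW F0)//.
    by rewrite /K lerDl divr_ge0// ltW.
  by apply: Fmono => //; apply: ltW.
move=> xx0 IH; have x_0 : 0 < x by apply: lt_le_trans xx0.
apply: (@integral_le_split _ _ _ P _ [set w | ((V w)%:R <= x)%R] _ (K * (x * F x)) (2 * x * F x)) => //.
- rewrite (_ : _ `&` _ = [set w | ((V w)%:R <= x)%R])//.
  apply/seteqP; split => [w []//|w /= wx]; split => //; lra.
- apply: integral_le_cst => //; first (apply: measurableD; exact: mle).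
  + by move=> w [/= -> _]; rewrite ler0n.
  + by lra.
  + rewrite -tV ?(ltW x_0)//; apply: le_measure.
    * rewrite inE; apply: measurableD; exact: mle.
    * rewrite inE; exact: mgt.
    * by move=> w [_ /= /negP]; rewrite -ltNge.
have /andP[dF _] := doubling xx0.
have h : K + 2 <= K * (2 * q1).
  suff : 2 <= K * (2 * q1 - 1) by lra.
  rewrite /K mulrDl divfK ?gt_eqF// lerDr mulr_ge0// ?invr_ge0 ltW//.
have Fx := Fpos (ltW x_0).
apply: (@le_trans _ _ ((K + 2) * (x * F x))); first by lra.
apply: (@le_trans _ _ (K * (2 * q1) * (x * F x))).
  by rewrite ler_wpM2r// mulr_ge0// ltW.
rewrite -mulrA ler_pM2l// (_ : 2 * q1 * (x * F x) = 2 * x * (q1 * F x)); last by ring.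
by rewrite ler_pM2l//; lra.
Qed.

(** The blocks from 2^n x to 2^(n+1) x contribute at most a geometric series of
    ratio [2 `^ s * q2 < 1].  The induction on the number of blocks bounds the
    truncated integrals uniformly, so that finiteness of the moment need not be
    known beforehand. *)
Lemma tail_moment : exists2 K, 0 < K & forall V, has_tail V ->
  forall x : R, x0 <= x ->
  (\int[P]_(w in [set w | (x < (V w)%:R)%R]) ((V w)%:R `^ s)%:E <= (K * (x `^ s * F x))%:E)%E.
Proof.
have q2' : 0 < 1 - 2 `^ s * q2 by rewrite subr_gt0.
set K := 2 `^ s / (1 - 2 `^ s * q2).
have K0 : 0 < K by rewrite divr_gt0// powR_gt0.
exists K => // V [mV tV]; have mVR : discrete_fun (fun w => (V w)%:R : R).
  exact: (discrete_comp (fun n : nat => n%:R : R)).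
have mle (y : R) : measurable [set w | ((V w)%:R <= y)%R].
  exact: (measurable_discrete_pred (fun u : R => u <= y) mVR).
have mgt (y : R) : measurable [set w | (y < (V w)%:R)%R].
  exact: (measurable_discrete_pred (fun u : R => y < u) mVR).
have mVs : discrete_fun (fun w => (V w)%:R `^ s : R).
  exact: (discrete_comp (fun n : nat => n%:R `^ s : R)).
pose D (x : R) (n : nat) := [set w | (x < (V w)%:R <= 2 ^+ n * x)%R].
have mD x n : measurable (D x n) by exact: (measurable_discrete_pred (fun u : R => (x < u <= 2 ^+ n * x)%R) mVR).
have HD n x : x0 <= x ->
    (\int[P]_(w in D x n) ((V w)%:R `^ s)%:E <= (K * (x `^ s * F x))%:E)%E.
  elim: n x => [|n IH] x xx0; have x_0 : 0 < x by apply: lt_le_trans xx0.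
    rewrite (_ : D x 0%N = set0).
      by rewrite integral_set0 lee_fin mulr_ge0 ?(ltW K0)// mulr_ge0 ?powR_ge0// ltW// Fpos// ltW.
    apply/seteqP; split => w //=; rewrite /D/= expr0 mul1r => /andP[h1 h2]; lra.
  have x2 : x0 <= 2 * x by lra.
  apply: (@integral_le_split _ _ _ P _ [set w | ((V w)%:R <= 2 * x)%R] _
    ((2 * x) `^ s * F x) (K * ((2 * x) `^ s * F (2 * x)))) => //.
  - apply: integral_le_cst => //.
    + exact: measurableI.
    + by move=> w [_ /= h]; rewrite powR_ge0/= powR_le ?(ltW s0).
    + exact: powR_ge0.
    + rewrite -tV ?(ltW x_0)//; apply: le_measure.
      * rewrite inE; exact: measurableI.
      * rewrite inE; exact: mgt.
      * by move=> w [/= /andP[]].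
  - apply: le_trans (IH _ x2); apply: ge0_subset_integral => //.
    + exact: measurableD.
    + exact: measurable_EFin_discrete.
    + move=> w [/= /andP[h1 h2] /negP]; rewrite -ltNge /D/= => ->/=.
      by rewrite mulrA -exprSr.
  have /andP[_ dF] := doubling xx0.
  have Fx := Fpos (ltW x_0); have ps : 0 < x `^ s by rewrite powR_gt0.
  rewrite powRM// ?(ltW x_0)//.
  have hK : 2 `^ s + K * (2 `^ s * q2) = K by rewrite /K; field; rewrite gt_eqF.
  have p2 : 0 < (2:R) `^ s by rewrite powR_gt0.
  apply: (@le_trans _ _ (2 `^ s * x `^ s * F x + K * (2 `^ s * x `^ s * (q2 * F x)))).
    by rewrite lerD2l ler_pM2l// ler_pM2l// mulr_gt0.
  rewrite le_eqVlt; apply/orP; left; apply/eqP; rewrite -[in RHS]hK; ring.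
move=> x xx0; have x_0 : 0 < x by apply: lt_le_trans xx0.
rewrite (_ : [set w | _] = \bigcup_n D x n); last first.
  apply/seteqP; split => [w /= xw|w [n _ /andP[]//]].
  exists (V w) => //; rewrite /D/= xw/=; apply: (@le_trans _ _ (2 ^+ V w)).
    by rewrite -natrX ler_nat ltnW// ltn_expl.
  by rewrite ler_peMr ?exprn_ge0// (le_trans x01).
have cv : (\int[P]_(w in D x n) ((V w)%:R `^ s)%:E)%E @[n --> \oo] -->
    (\int[P]_(w in \bigcup_n D x n) ((V w)%:R `^ s)%:E)%E.
  apply: ge0_nondecreasing_set_cvg_integral => //.
  - move=> n m nm; apply/subsetPset => w; rewrite /D/= => /andP[-> h]/=.
    by rewrite (le_trans h)// ler_wpM2r ?(ltW x_0)// ler_weXn2l// ler1n.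
  - by move=> n; exact: measurable_EFin_discrete.
rewrite -(cvg_lim _ cv)//; apply: lime_le; first by apply/cvg_ex; eexists; exact: cv.
by near=> n; exact: HD.
Unshelve. all: by end_near. Qed.

(** The two previous bounds, on either side of [a]; below [x0] the value at [x0]
    is used instead, at the price of a factor [x0]. *)
Lemma trunc_pow_moment : exists2 C, 0 < C & forall V, has_tail V ->
  forall a : R, 1 <= a ->
  (\int[P]_w (trunc_pow s ((V w)%:R / a))%:E <= (C * F a)%:E)%E.
Proof.
have [K1 K10 H1] := truncated_mean; have [K2 K20 H2] := tail_moment.
exists (x0 * (K1 + K2)) => [|V tV a a1]; first by rewrite mulr_gt0// addr_gt0.
have [mV _] := tV.
have mVR (h : R -> R) : discrete_fun (fun w => h (V w)%:R).
  exact: (discrete_comp (fun n : nat => h n%:R)).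
have mle (y : R) : measurable [set w | ((V w)%:R <= y)%R].
  exact: (measurable_discrete_pred (fun u : R => u <= y) (mVR id)).
have big (b : R) : x0 <= b ->
    (\int[P]_w (trunc_pow s ((V w)%:R / b))%:E <= ((K1 + K2) * F b)%:E)%E.
  move=> xb; have b0 : 0 < b by apply: lt_le_trans xb.
  apply: (@integral_le_split _ _ _ P setT [set w | ((V w)%:R <= b)%R] _
    (b^-1 * (K1 * (b * F b))) (b `^ (- s) * (K2 * (b `^ s * F b)))) => //.
  - exact: (mVR (fun y => trunc_pow s (y / b))).
  - by move=> w _; rewrite trunc_pow_ge0// divr_ge0// ltW.
  - rewrite setTI; apply: integral_leM (H1 V tV b xb) => //.
    + exact: (mVR (fun y => trunc_pow s (y / b))).
    + exact: (mVR id).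
    + move=> w _; rewrite trunc_pow_ge0 ?divr_ge0 ?(ltW b0)//=.
      by rewrite ge_min mulrC lexx.
    + by rewrite invr_ge0 ltW.
  - rewrite setTD (_ : ~` _ = [set w | b < (V w)%:R]); last first.
      by apply/seteqP; split => w /=; rewrite ltNge => /negP.
    apply: integral_leM (H2 V tV b xb) => //.
    + exact: (measurable_discrete_pred (fun u : R => b < u) (mVR id)).
    + exact: (mVR (fun y => trunc_pow s (y / b))).
    + exact: (mVR (fun y => y `^ s)).
    + move=> w _; rewrite trunc_pow_ge0 ?divr_ge0 ?(ltW b0)//=.
      rewrite ge_min; apply/orP; right.
      by rewrite powRM ?invr_ge0 ?(ltW b0)// -powR_inv1 ?(ltW b0)// powRAC powR_inv1 ?powR_ge0// -powRN mulrC.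
    + exact: powR_ge0.
  - rewrite powRN le_eqVlt; apply/orP; left; apply/eqP; field.
    by rewrite !gt_eqF// powR_gt0.
have Fa := Fpos (le_trans ler01 a1); have a0 : 0 < a by apply: lt_le_trans a1.
have [xa|ax] := leP x0 a.
  apply: le_trans (big a xa) _; rewrite lee_fin ler_pM2r//.
  by rewrite ler_peMl// addr_ge0// ltW.
apply: (@le_trans _ _ (x0 * ((K1 + K2) * F x0))%:E).
  apply: integral_leM (big x0 (lexx _)) => //.
  - exact: (mVR (fun y => trunc_pow s (y / a))).
  - exact: (mVR (fun y => trunc_pow s (y / x0))).
  - move=> w _; rewrite trunc_pow_ge0 ?divr_ge0 ?(ltW a0)//=.
    have k1 : 1 <= x0 / a by rewrite ler_pdivlMr// mul1r ltW.
    have -> : (V w)%:R / a = (x0 / a) * ((V w)%:R / x0).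
      by field; rewrite !gt_eqF.
    apply: (le_trans (trunc_pow_scale s1 k1 _)); first by rewrite divr_ge0// ltW.
    rewrite ler_wpM2r//; first by rewrite trunc_pow_ge0// divr_ge0// ltW.
    by rewrite ler_pdivrMr// ler_peMr// ltW.
  - by move=> w _; rewrite trunc_pow_ge0// divr_ge0// ltW.
  - exact: ltW.
rewrite lee_fin mulrA ler_pM2l ?mulr_gt0 ?addr_gt0//.
by apply: Fmono; exact: ltW.
Qed.

Lemma power_moment : exists2 C, 0 < C & forall V, has_tail V ->
  (\int[P]_w ((V w)%:R `^ s)%:E <= C%:E)%E.
Proof.
have [C C0 HC] := trunc_pow_moment; exists (C * F 1) => [|V tV].
  by rewrite mulr_gt0// Fpos.
apply: le_trans (HC V tV 1 (lexx _)); have [mV _] := tV.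
rewrite le_eqVlt; apply/orP; left; apply/eqP; apply: eq_integral => w _.
congr EFin; rewrite divr1 /trunc_pow; apply/esym/min_idPr.
case: (V w) => [|n]; first by rewrite powR0 ?gt_eqF.
by rewrite ler1_powR ?ler1n// ltW.
Qed.

(** Here [M] plays the role of a sum or maximum of [m] variables of tail [F], seen
    on an event [E] of probability at most [c], and [a] that of its typical size.
    Going from [x] to [2 * x] adds at most x^(- s) c / (m F (2 x)) to the integral,
    whereas the bound x^(- s) c / (m F x) is multiplied by at least
    [(2 `^ s * q2)^-1 > 1]; so the integral below [a / 2] is dominated by its last
    dyadic block, and above [a / 2] the integrand is at most (a/2)^(- s). *)
Lemma negative_moment : exists2 K, 0 < K &
  forall (M : T -> R) (E : set T) (c m : R),
  discrete_fun M -> measurable E -> (forall w, 1 <= M w) -> 0 <= c -> 0 < m ->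
  (P E <= c%:E)%E ->
  (forall x : R, 1 <= x ->
    (P (E `&` [set w | (M w <= x)%R]) <= (c / (m * F x))%:E)%E) ->
  forall a : R, 0 < a -> (forall x : R, 1 <= x < a -> 1 <= m * F x) ->
  (\int[P]_(w in E) ((M w) `^ (- s))%:E <= (K * (a `^ (- s) * c))%:E)%E.
Proof.
have p20 : 0 < (2:R) `^ s by rewrite powR_gt0.
have q2' : 0 < 1 - 2 `^ s * q2 by rewrite subr_gt0.
(* the first summand handles x <= 2 * x0, the second makes
   2 `^ s * (K0 * q2 + 1) <= K0 *)
set K0 := (2 * x0) `^ s + 2 `^ s / (1 - 2 `^ s * q2).
have K00 : 0 < K0 by rewrite addr_gt0 ?divr_gt0// powR_gt0// mulr_gt0.
exists ((2 * x0) `^ s + 2 `^ s * (K0 + 1)).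
  apply: addr_gt0; first by rewrite powR_gt0// mulr_gt0.
  by rewrite mulr_gt0// addr_gt0.
move=> M E c m mM mE M1 c0 m0 PE PM a a0 Ha.
have mMs : discrete_fun (fun w => M w `^ (- s)).
  exact: (discrete_comp (fun u : R => u `^ (- s))).
have mle (y : R) : measurable [set w | M w <= y].
  exact: (measurable_discrete_pred (fun u : R => u <= y) mM).
have M0 w : 0 < M w by apply: lt_le_trans (M1 w).
have Ms1 w : 0 <= M w `^ (- s) <= 1.
  rewrite powR_ge0 -[leRHS](powRr0 (M w))/=.
  by rewrite ler_powR// oppr_le0 ltW.
have low : forall x, x0 <= x ->
    (\int[P]_(w in E `&` [set w | (M w <= x)%R]) (M w `^ (- s))%:E <=
     (K0 * (x `^ (- s) * (c / (m * F x))))%:E)%E.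
  apply: dyadic_induction => x.
    move=> /andP[xx0 x2]; have x_0 : 0 < x by apply: lt_le_trans xx0.
    have x_1 : 1 <= x by apply: le_trans xx0.
    have Fx := Fpos (ltW x_0).
    have r0 : 0 <= c / (m * F x) by rewrite divr_ge0// mulr_ge0// ltW.
    apply: (@le_trans _ _ (1 * (c / (m * F x)))%:E).
      apply: integral_le_cst => //; first exact: measurableI.
      exact: PM.
    rewrite lee_fin [leRHS]mulrA ler_wpM2r//.
    rewrite -[leLHS](@mulfV _ ((2 * x0) `^ s)) ?gt_eqF ?powR_gt0 ?mulr_gt0//.
    apply: ler_pM; rewrite ?powR_ge0 ?invr_ge0 ?powR_ge0//.
      by rewrite /K0 lerDl divr_ge0// ltW.
    by rewrite -powRN powRN_le// ltW.
  move=> xx0 IH; have x_0 : 0 < x by apply: lt_le_trans xx0.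
  have x_1 : 1 <= x by apply: le_trans xx0.
  have x2_1 : 1 <= 2 * x by rewrite (le_trans x_1)// ler_peMl ?ler1n// ltW.
  have Fx := Fpos (ltW x_0).
  have F2x : 0 < F (2 * x) by rewrite Fpos// mulr_ge0// ltW.
  apply: (@integral_le_split _ _ _ P _ [set w | (M w <= x)%R] _
    (K0 * (x `^ (- s) * (c / (m * F x)))) (x `^ (- s) * (c / (m * F (2 * x))))) => //.
  - exact: measurableI.
  - by move=> w _; apply: powR_ge0.
  - rewrite (_ : _ `&` _ `&` _ = E `&` [set w | M w <= x])//.
    apply/seteqP; split => [w [[? _] ?]//|w [Ew /= wx]]; split => //; split => //=.
    by rewrite (le_trans wx)// ler_peMl ?ler1n// ltW.
  - apply: integral_le_cst => //.
    + by apply: measurableD => //; exact: measurableI.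
    + move=> w [_ /= /negP]; rewrite -ltNge => xM.
      by rewrite powR_ge0/= powRN_le// ltW.
    + exact: powR_ge0.
    + apply: le_trans (PM _ x2_1); apply: le_measure => //.
      * by rewrite inE; apply: measurableD => //; exact: measurableI.
      * by rewrite inE; exact: measurableI.
  have /andP[_ dF] := doubling xx0.
  have hK : 2 `^ s * (K0 * q2 + 1) <= K0.
    suff : 2 `^ s <= K0 * (1 - 2 `^ s * q2) by rewrite mulrBr mulr1 lerBrDr mulrDr mulr1 addrC (mulrCA K0).
    by rewrite /K0 mulrDl divfK ?gt_eqF// lerDr mulr_ge0 ?powR_ge0// ltW.
  have iF : c / (m * F x) <= q2 * (c / (m * F (2 * x))).
    rewrite mulrCA ler_wpM2l// invfM invfM mulrCA ler_pM2l ?invr_gt0//.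
    by rewrite -div1r ler_pdivrMr// mulrAC ler_pdivlMr// mul1r.
  have r0 : 0 <= c / (m * F (2 * x)) by rewrite divr_ge0// mulr_ge0// ltW.
  set r := c / (m * F (2 * x)) in iF r0 *.
  apply: (@le_trans _ _ (K0 * (x `^ (- s) * (q2 * r)) + x `^ (- s) * r)).
    by rewrite lerD2r ler_pM2l// ler_wpM2l// powR_ge0.
  rewrite powRM// ?(ltW x_0)// (powRN 2).
  rewrite (_ : _ + _ = (2 `^ s * (K0 * q2 + 1)) * ((2 `^ s)^-1 * x `^ (- s) * r)); last first.
    by field; rewrite gt_eqF.
  by apply: ler_wpM2r => //; apply: mulr_ge0 => //; apply: mulr_ge0; rewrite ?invr_ge0 ?powR_ge0.
have as0 : 0 <= a `^ (- s) * c by rewrite mulr_ge0 ?powR_ge0.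
have [ax|xa] := leP a (2 * x0).
  apply: (@le_trans _ _ (1 * c)%:E); first exact: integral_le_cst.
  rewrite lee_fin mulrA ler_wpM2r//.
  rewrite -[leLHS](@mulfV _ ((2 * x0) `^ s)) ?gt_eqF ?powR_gt0 ?mulr_gt0//.
  apply: ler_pM; rewrite ?powR_ge0 ?invr_ge0 ?powR_ge0//.
    by rewrite lerDl mulr_ge0 ?powR_ge0// addr_ge0// ltW.
  by rewrite -powRN powRN_le// ltW.
have xa2 : x0 <= a / 2 by rewrite ler_pdivlMr// mulrC ltW.
have a20 : 0 < a / 2 by rewrite divr_gt0.
apply: (@integral_le_split _ _ _ P _ [set w | (M w <= a / 2)%R] _
    (K0 * ((a / 2) `^ (- s) * c)) ((a / 2) `^ (- s) * c)) => //.
- by move=> w _; apply: powR_ge0.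
- apply: le_trans (low _ xa2) _; rewrite lee_fin ler_pM2l// ler_wpM2l ?powR_ge0//.
  have Fa := Fpos (ltW a20).
  rewrite ler_pdivrMr ?mulr_gt0// ler_peMr// Ha// (le_trans x01 xa2)/=.
  by rewrite ltr_pdivrMr// ltr_pMr// ltr1n.
- apply: integral_le_cst => //.
  + exact: measurableD.
  + move=> w [_ /= /negP]; rewrite -ltNge => xM.
    by rewrite powR_ge0/= powRN_le// ltW.
  + exact: powR_ge0.
  + apply: le_trans PE; apply: le_measure => //; rewrite ?inE//.
    exact: measurableD.
have -> : (a / 2) `^ (- s) = 2 `^ s * a `^ (- s).
  by rewrite powRM ?invr_ge0 ?(ltW a0)// -powR_inv1// -powRrM mulN1r opprK mulrC.
rewrite (_ : _ + _ = (2 `^ s * (K0 + 1)) * (a `^ (- s) * c)); last by ring.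
by rewrite ler_wpM2r// lerDr powR_ge0.
Qed.

End Moments.

(** * Degrees in the multigraph *)

Section GraphCombinatorics.
Variables (T : Type) (W : nat -> T -> nat) (Y : nat -> nat -> T -> nat) (w : T).
Hypothesis Yold : forall t e, (1 <= t)%N -> (e < W t w)%N -> (Y t e w < t)%N.

Definition num_edges (t : nat) : nat := (\sum_(1 <= j < t.+1) W j w)%N.

Lemma num_edgesS t : num_edges t.+1 = (num_edges t + W t.+1 w)%N.
Proof. by rewrite /num_edges big_nat_recr. Qed.

Lemma degreeS i t : degree W Y i t.+1 w =
  (degree W Y i t w + ((i == t.+1) * W t.+1 w +
   count (fun e => Y t.+1 e w == i) (iota 0 (W t.+1 w))))%N.
Proof.
have io : iota 1 t.+1 = iota 1 t ++ [:: t.+1] by rewrite -(addn1 t) iotaD addnC.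
rewrite /degree /edges io map_cat flatten_cat !count_cat/= !addn0.
rewrite addnACA !count_map; congr (_ + (_ + _))%N.
case: eqVneq => [->|it].
  by rewrite mul1n -[RHS](size_iota 0); apply/eqP; rewrite -all_count; apply/allP => e _ /=.
rewrite mul0n; apply/eqP; rewrite -leqn0 leqNgt -has_count; apply/hasPn => e _ /=.
by rewrite eq_sym.
Qed.

Lemma degree0 i : degree W Y i 0 w = 0%N.
Proof. by []. Qed.

Lemma degree_mono i : {homo (fun t => degree W Y i t w) : t t' / (t <= t')%N}.
Proof. by apply: homo_leq => // [t1 t2 t3|t]; [exact: leq_trans|rewrite degreeS leq_addr]. Qed.

Lemma count_attach_new i t : (t < i)%N ->
  count (fun e => Y t.+1 e w == i) (iota 0 (W t.+1 w)) = 0%N.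
Proof.
move=> ti; apply/eqP; rewrite -leqn0 leqNgt -has_count; apply/hasPn => e.
rewrite mem_iota/= add0n => eW; rewrite neq_ltn (leq_trans (Yold _ eW))//.
Qed.

Lemma degree_unborn i t : (t < i)%N -> degree W Y i t w = 0%N.
Proof.
elim: t => [//|t IH] ti; rewrite degreeS IH ?(ltnW ti)// count_attach_new ?(ltnW ti)//.
by rewrite gtn_eqF.
Qed.

(** The maximum treats the two vertices of the initial graph alike: v_0 has
    degree W_1 in G(1), just as v_1. *)
Lemma degree_birth i : degree W Y i (maxn i 1) w = W (maxn i 1) w.
Proof.
case: i => [|i].
  rewrite (_ : maxn 0 1 = 1%N)// degreeS degree0 add0n mul0n add0n.
  rewrite -[RHS](size_iota 0); apply/eqP; rewrite -all_count; apply/allP => e /=.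
  by rewrite mem_iota/= add0n => /(Yold (leqnn 1)); rewrite ltnS leqn0.
rewrite (maxn_idPl _)// degreeS degree_unborn// count_attach_new// eqxx mul1n.
by rewrite addn0.
Qed.

Lemma handshake t : (\sum_(0 <= j < t.+1) degree W Y j t w)%N = (2 * num_edges t)%N.
Proof.
elim: t => [|t IH]; first by rewrite big_nat1 /num_edges big_geq.
rewrite (eq_bigr _ (fun j _ => degreeS j t)) big_split/=.
rewrite big_nat_recr//= IH degree_unborn// addn0 num_edgesS mulnDr; congr addn.
rewrite big_split/= mul2n -addnn; congr addn.
  rewrite big_nat_recr//= eqxx mul1n big_nat big1 ?add0n// => j /andP[_ jt].
  by rewrite ltn_eqF.
rewrite (eq_bigr (fun j => \sum_(e <- iota 0 (W t.+1 w)) (Y t.+1 e w == j)))%N; last first.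
  by move=> j _; rewrite -sum1_count big_mkcond/=; apply: eq_bigr => e _; case: eqP.
rewrite exchange_big/= -[RHS](size_iota 0) -sum1_size big_seq [RHS]big_seq.
apply: eq_bigr => e; rewrite mem_iota/= add0n => eW.
have Yt : (Y t.+1 e w < t.+2)%N by rewrite ltnW// ltnS; exact: (Yold _ eW).
rewrite big_mkord (bigD1 (Ordinal Yt))//= eqxx big1 ?addn0// => j /negP jY.
by case: eqP => // Yj; case: jY; apply/eqP/val_inj.
Qed.

End GraphCombinatorics.

Lemma eq_num_edges (T : Type) (W : nat -> T -> nat) k w w' :
  (forall i, (0 < i <= k)%N -> W i w = W i w') -> num_edges W w k = num_edges W w' k.
Proof.
move=> H; rewrite /num_edges big_nat [RHS]big_nat.
by apply: eq_bigr => i /andP[i0 ik]; rewrite H// i0.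
Qed.

Lemma init_degree_le_num_edges (T : Type) (W : nat -> T -> nat) k i w :
  (0 < i <= k)%N -> (W i w <= num_edges W w k)%N.
Proof.
move=> /andP[i0 ik]; rewrite /num_edges (bigD1_seq i) ?iota_uniq//=.
  exact: leq_addr.
by rewrite mem_index_iota i0.
Qed.

(** * Law of one attached edge *)

Section Attachment.
Context (d : measure_display) (T : measurableType d) (R : realType).
Variables (P : probability T R) (delta : R) (W : nat -> {RV P >-> nat})
  (Y : nat -> nat -> {RV P >-> nat}).
Hypothesis hG : parid delta W Y.

Lemma discrete_rv (X : {RV P >-> nat}) : discrete_fun X.
Proof. by move=> A; rewrite -[X in measurable X]setTI; exact: (measurable_funPT X). Qed.

Lemma discrete_degree i t : discrete_fun (degree W Y i t).
Proof.
elim: t => [|t IH].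
  by apply: (discrete_fun_factor (discrete_rv (W 0))) => w w' _; rewrite !degree0.
have mc : discrete_fun (fun w => count (fun e => Y t.+1 e w == i) (iota 0 (W t.+1 w))).
  apply: (discrete_glue (g := W t.+1)
    (f := fun v w => count (fun e => Y t.+1 e w == i) (iota 0 v))); first exact: discrete_rv.
  move=> v; apply: (discrete_fun_factor (@discrete_seq _ _ _ _ (fun e => Y t.+1 e) (iota 0 v)
    (fun e => discrete_rv (Y t.+1 e)))) => w w' eqY.
  have cE z : count (fun e => Y t.+1 e z == i) (iota 0 v) =
      count (pred1 i) [seq Y t.+1 e z | e <- iota 0 v] by rewrite count_map.
  by rewrite !cE eqY.
apply: (discrete_fun_factor (discrete_pair IH (discrete_pair (discrete_rv (W t.+1)) mc))).
by move=> w w' [h1 h2 h3]; rewrite !degreeS h1 h3 h2.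
Qed.

Definition degrees n w : seq nat := [seq degree W Y j n w | j <- iota 0 n.+1].

Lemma discrete_degrees n : discrete_fun (degrees n).
Proof. by apply: discrete_seq => j; exact: discrete_degree. Qed.

Lemma attach_prob_degrees n w w' j : degrees n w = degrees n w' -> (j < n.+1)%N ->
  attach_prob W Y delta n.+1 j w = attach_prob W Y delta n.+1 j w'.
Proof.
move=> eqd jn.
have dE k : (k < n.+1)%N -> degree W Y k n w = degree W Y k n w'.
  move=> kn; have := congr1 (fun s => nth 0%N s k) eqd.
  by rewrite !(nth_map 0%N) ?size_iota// nth_iota.
rewrite /attach_prob dE//; congr (_ / _); rewrite [LHS]big_nat [RHS]big_nat.
by apply: eq_bigr => k /andP[_ kn]; rewrite dE.
Qed.

(** Marginal law of one endpoint.  On [B] the number of edges is the constant [m],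
    so the event splits over the assignments of the [m] endpoints that send edge
    [e] to [i]; their conditional probabilities are products, and summing out the
    other edges leaves one factor, the attachment probabilities having sum 1. *)
Lemma attach_measure n (B : set T) m e i : (0 < n)%N ->
  measurable B -> <<s history W Y n >> B ->
  (forall w, B w -> W n.+1 w = m) ->
  (forall w j, B w -> (j < n.+1)%N -> 0 <= attach_prob W Y delta n.+1 j w) ->
  (forall w, B w -> \sum_(0 <= j < n.+1) attach_prob W Y delta n.+1 j w = 1) ->
  (e < m)%N -> (i < n.+1)%N ->
  (P (B `&` [set w | Y n.+1 e w = i]) =
   \int[P]_(w in B) (attach_prob W Y delta n.+1 i w)%:E)%E.
Proof.
move=> n0 mB sB BW p0 p1 em i_n.
pose p j w := attach_prob W Y delta n.+1 j w.
pose oe : 'I_m := Ordinal em; pose oi : 'I_n.+1 := Ordinal i_n.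
(* the assignment x of endpoints, extended by 0 to all edge numbers *)
pose X (x : {ffun 'I_m -> 'I_n.+1}) k := oapp (fun o => nat_of_ord (x o)) 0%N (insub k).
have XE x (o : 'I_m) : X x o = x o by rewrite /X valK.
have Xn x k : (X x k < n.+1)%N by rewrite /X; case: (insub k) => [y|//]; exact: ltn_ord.
pose A x := [set w | forall k, (k < W n.+1 w)%N -> Y n.+1 k w = X x k].
have mA x : measurable (A x).
  pose f v w := all (fun k => Y n.+1 k w == X x k) (iota 0 v).
  rewrite (_ : A x = (fun w => f (W n.+1 w) w) @^-1` [set true]).
    apply: (discrete_glue (f := f)); first exact: discrete_rv.
    move=> v; apply: (discrete_fun_factor (@discrete_seq _ _ _ _ (fun e => Y n.+1 e) (iota 0 v)
      (fun e => discrete_rv (Y n.+1 e)))) => w w' eqY.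
    apply/eq_in_all => k kv; have := congr1 (fun s => nth 0%N s k) eqY.
    move: kv; rewrite mem_iota add0n /= => kv.
    by rewrite !(nth_map 0%N) ?size_iota// nth_iota// add0n => ->.
  apply/seteqP; split => w /=.
    by move=> Aw; apply/allP => k; rewrite mem_iota add0n /= => /Aw/eqP.
  by move=> /allP Aw k kW; apply/eqP/Aw; rewrite mem_iota.
have HA x : P (A x `&` B) = (\int[P]_(w in B) (\prod_(o < m) p (x o) w)%:E)%E.
  have [_ /(_ B sB) ->] := parid_attach hG (t := n.+1) (x := X x) n0 (Xn x).
  apply: eq_integral => w; rewrite inE => Bw; congr EFin.
  by rewrite BW// big_mkord; apply: eq_bigr => o _; rewrite XE.
pose s := enum [pred x : {ffun 'I_m -> 'I_n.+1} | x oe == oi].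
have mp (x : {ffun 'I_m -> 'I_n.+1}) : discrete_fun (fun w => \prod_(o < m) p (x o) w).
  apply: (discrete_fun_factor (discrete_degrees n)) => w w' dw.
  by apply: eq_bigr => o _; exact: attach_prob_degrees.
have -> : (P (B `&` [set w | Y n.+1 e w = i]) =
   \int[P]_(w in B) (\sum_(x <- s) (\1_(A x) w)%:E))%E.
  have mYi : measurable [set w | Y n.+1 e w = i] by exact: (discrete_rv _ [set i]).
  rewrite setIC -integral_indic//; apply: eq_integral => w; rewrite inE => Bw.
  pose xw : {ffun 'I_m -> 'I_n.+1} := [ffun o : 'I_m => inord (Y n.+1 o w)].
  have Yn k : (k < m)%N -> (Y n.+1 k w < n.+1)%N.
    by move=> km; apply: (parid_old hG); rewrite ?BW.
  have AE x : (w \in A x) = (x == xw).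
    apply/idP/eqP => [|->]; rewrite inE.
      move=> Aw; apply/ffunP => o; apply/val_inj; rewrite ffunE /= inordK ?Yn//.
      by rewrite Aw ?BW// XE.
    move=> k; rewrite BW// => km.
    by rewrite -[k in RHS]/(nat_of_ord (Ordinal km)) XE ffunE inordK ?Yn.
  rewrite big_enum sumEFin/=; congr EFin; rewrite indicE.
  under eq_bigr do rewrite indicE AE.
  have [Yi|Yi] := eqVneq (Y n.+1 e w) i.
    have xwi : xw oe == oi by apply/eqP/val_inj; rewrite ffunE /= inordK ?Yn.
    rewrite mem_set// (bigD1 xw)//= eqxx big1 ?addr0// => x /andP[_ /negPf ->//].
  rewrite memNset; last by move/eqP; rewrite (negPf Yi).
  rewrite big1// => x; case: eqP => // -> /eqP/(congr1 val).
  by rewrite ffunE /= inordK ?Yn//= => /eqP; rewrite (negPf Yi).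
rewrite ge0_integral_sum//; last first.
  by move=> x; apply: measurable_funTS; apply/measurable_EFinP; exact: measurable_indic.
have HI x : (\int[P]_(w in B) (\1_(A x) w)%:E =
    \int[P]_(w in B) (\prod_(o < m) p (x o) w)%:E)%E.
  by rewrite integral_indic//; exact: HA.
under eq_bigr do rewrite HI.
rewrite -ge0_integral_sum//; first last.
- by move=> x w Bw; rewrite lee_fin; apply: prodr_ge0 => o _; exact: p0.
- by move=> x; exact: measurable_EFin_discrete.
apply: eq_integral => w; rewrite inE => Bw; rewrite big_enum sumEFin/=; congr EFin.
(* distributing the product over the choice of each endpoint, edge e being
   restricted to the single choice i *)
pose Q (o : 'I_m) := [pred j : 'I_n.+1 | (o == oe) ==> (j == oi)].
rewrite (eq_bigl (fun x => x \in family Q)); last first.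
  move=> x; apply/idP/familyP => [xi o|/(_ oe)]; rewrite inE ?eqxx//.
  by apply/implyP => /eqP ->.
rewrite -(bigA_distr_big_dep _ (fun _ j => p (nat_of_ord j) w)) (bigD1 oe)//= [X in _ * X]big1.
  by rewrite mulr1 (big_pred1 oi)// => j /=; rewrite eqxx.
move=> o /negPf ooe; rewrite -[RHS](p1 w Bw) big_mkord; apply: eq_bigl => j.
by rewrite ooe.
Qed.

End Attachment.

(** * Degrees given the initial degrees *)

Section Atoms.
Context (d : measure_display) (T : measurableType d) (R : realType).
Variables (P : probability T R) (delta : R) (W : nat -> {RV P >-> nat})
  (Y : nat -> nat -> {RV P >-> nat}).
Hypothesis hG : parid delta W Y.

Let kappa : R := delta + inf [set (n%:R : R) | n in init_support P (W 1%N)].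

Let kappa0 : 0 < kappa. Proof. exact: parid_delta hG. Qed.

Lemma init_degree_below_support j n : (0 < j)%N -> n%:R + delta < kappa ->
  P (W j @^-1` [set n]) = 0%E.
Proof.
move=> j0; rewrite /kappa addrC ltrD2l => nk.
rewrite (parid_ident hG (i := j) (j := 1%N))//; apply/eqP.
rewrite eq_le measure_ge0 andbT leNgt; apply/negP => Pn.
move: nk; apply/negP; rewrite -leNgt; apply: ge_inf; last by exists n.
by exists 0 => _ [k _ <-].
Qed.

(** The atom of the sigma-algebra of W_1, ..., W_t that contains [w0]. *)
Definition init_atom t w0 : set T := [set w | forall j, (0 < j <= t)%N -> W j w = W j w0].

Lemma init_atom_history n t w0 : <<s history W Y n >> (init_atom t w0).
Proof.
rewrite (_ : init_atom t w0 =
    \bigcap_(j in [set j | (0 < j <= t)%N]) (W j @^-1` [set W j w0])); last first.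
  by apply/seteqP; split => w H j /H.
apply: (@bigcap_measurableType _ (g_sigma_algebraType (history W Y n))) => j /= /andP[j0 _].
by apply: sub_sigma_algebra; right; exists j, (W j w0).
Qed.

Lemma measurable_init_atom t w0 : measurable (init_atom t w0).
Proof.
rewrite (_ : init_atom t w0 =
    \bigcap_(j in [set j | (0 < j <= t)%N]) (W j @^-1` [set W j w0])); last first.
  by apply/seteqP; split => w H j /H.
by apply: bigcap_measurableType => j _; exact: discrete_rv.
Qed.

Section GoodAtom.
Variables (t : nat) (w0 : T).
Hypothesis good : forall j, (0 < j <= t)%N -> kappa <= (W j w0)%:R + delta.
Let B := init_atom t w0.
Let L n : R := (num_edges W w0 n)%:R.
Let S n : R := 2 * L n + n.+1%:R * delta.
Let Kd : R := 1 + `|delta| / kappa.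

Let Kd1 : 1 <= Kd. Proof. by rewrite lerDl divr_ge0// ltW. Qed.

(** The shift by a negative [delta] costs a constant factor only, because the
    shifted value stays above [kappa > 0]. *)
Lemma le_shift (x : R) : kappa <= x + delta -> x <= Kd * (x + delta).
Proof.
move=> kx; have h : - delta <= `|delta| by rewrite -normrN ler_norm.
rewrite /Kd mulrDl mul1r -{1}[x](addrK delta) lerD2l (le_trans h)//.
by rewrite mulrAC ler_pdivlMr// ler_wpM2l.
Qed.

Lemma num_edgesR n : L n.+1 = L n + (W n.+1 w0)%:R.
Proof. by rewrite /L num_edgesS natrD. Qed.

Lemma num_edges_ge n : (n%:R : R) <= L n.
Proof.
elim: n => [//|n IH]; rewrite num_edgesR -natr1 lerD// ler1n.
exact: (parid_pos hG).
Qed.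

(** S_n is the sum of the shifted initial degrees and of [L n + delta >= 0]. *)
Lemma num_edges_le_weight n : (0 < n <= t)%N -> L n <= Kd * S n.
Proof.
move=> /andP[n0 nt]; have Kd0 : 0 <= Kd by rewrite (le_trans _ Kd1).
have h1 : L n <= Kd * (L n + n%:R * delta).
  elim: n nt {n0} => [|n IH] nt.
    by rewrite /L /num_edges big_geq// mul0r addr0 mulr0.
  rewrite num_edgesR.
  have -> : L n + (W n.+1 w0)%:R + n.+1%:R * delta =
      (L n + n%:R * delta) + ((W n.+1 w0)%:R + delta).
    by rewrite -natr1; ring.
  by rewrite mulrDr lerD ?IH ?(ltnW nt)// le_shift// good.
have h2 : 0 <= L n + delta.
  case: n n0 nt {h1} => // n _ nt; elim: n nt => [|n IH] nt.
    rewrite num_edgesR {1}/L /num_edges big_geq// add0r.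
    by rewrite (le_trans (ltW kappa0))// good.
  by rewrite num_edgesR addrAC addr_ge0// IH// ltnW.
rewrite (le_trans h1)// ler_wpM2l//.
have -> : S n = (L n + n%:R * delta) + (L n + delta) by rewrite /S -natr1; ring.
by rewrite lerDl.
Qed.

Lemma weight_gt0 n : (0 < n <= t)%N -> 0 < S n.
Proof.
move=> nt; have /andP[n0 _] := nt.
have Kd0 : 0 < Kd by rewrite (lt_le_trans _ Kd1).
rewrite -(pmulr_rgt0 _ Kd0); apply: lt_le_trans (num_edges_le_weight nt).
by apply: lt_le_trans (num_edges_ge n); rewrite ltr0n.
Qed.

Lemma weight_le n : (0 < n)%N -> S n <= (2 + 2 * `|delta|) * L n.
Proof.
move=> n0; rewrite /S [(2 + _) * _]mulrDl lerD2l.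
have h : n.+1%:R * delta <= n.+1%:R * `|delta| by rewrite ler_wpM2l// ler_norm.
rewrite (le_trans h)// mulrAC ler_wpM2r//.
apply: (@le_trans _ _ (2 * n%:R)); last by rewrite ler_wpM2l// num_edges_ge.
by rewrite -natrM ler_nat mul2n -addnn -addn1 leq_add2l.
Qed.

(** The weight grows by 2 W + delta, and W + delta is positive.  This slack is what
    makes the share of a vertex a supermartingale for negative [delta] too. *)
Lemma weightS n : (n < t)%N -> S n + (W n.+1 w0)%:R <= S n.+1.
Proof.
move=> nt; have -> : S n.+1 = S n + (W n.+1 w0)%:R + ((W n.+1 w0)%:R + delta).
  by rewrite /S num_edgesR -[n.+2%:R]natr1; ring.
by rewrite lerDl (le_trans (ltW kappa0))// good.
Qed.

Lemma atom_degree_lb i n w : B w -> (maxn i 1 <= n <= t)%N ->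
  kappa <= (degree W Y i n w)%:R + delta.
Proof.
move=> Bw /andP[kn nt]; have k0 : (0 < maxn i 1)%N by rewrite leq_max orbT.
have kt := leq_trans kn nt.
apply: (le_trans (good (j := maxn i 1) _)); first by rewrite k0.
rewrite lerD2r ler_nat -Bw ?k0//.
have old s e : (0 < s)%N -> (e < W s w)%N -> (Y s e w < s)%N by exact: (parid_old hG).
have <- : degree W Y i (maxn i 1) w = W (maxn i 1) w by exact: degree_birth.
exact: degree_mono.
Qed.

Lemma atom_weight n w : B w -> (n <= t)%N ->
  \sum_(0 <= j < n.+1) ((degree W Y j n w)%:R + delta) = S n.
Proof.
move=> Bw nt.
have old s e : (0 < s)%N -> (e < W s w)%N -> (Y s e w < s)%N by exact: (parid_old hG).
rewrite big_split/= sumr_const_nat subn0 -natr_sum (handshake old) natrM -[delta *+ _]mulr_natl.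
congr (_ * _%:R + _); apply: eq_num_edges => j /andP[j0 jn].
by rewrite Bw// j0 (leq_trans jn).
Qed.

Lemma atom_degreeS i n : (0 < n < t)%N -> (i <= n)%N ->
  (\int[P]_(w in B) ((degree W Y i n.+1 w)%:R + delta)%:E =
   (1 + (W n.+1 w0)%:R / S n)%:E * \int[P]_(w in B) ((degree W Y i n w)%:R + delta)%:E)%E.
Proof.
move=> /andP[n0 nt] i_n; set m := W n.+1 w0.
have mB : measurable B := measurable_init_atom t w0.
have Sn0 : 0 < S n by rewrite weight_gt0// n0 ltnW.
have BW w : B w -> W n.+1 w = m by move=> Bw; apply: Bw; rewrite nt.
have d0 j w : B w -> (j < n.+1)%N -> 0 <= (degree W Y j n w)%:R + delta.
  move=> Bw jn; apply: (le_trans (ltW kappa0)); apply: atom_degree_lb => //.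
  by rewrite geq_max -ltnS jn n0 ltnW.
have pE w j : B w -> attach_prob W Y delta n.+1 j w = ((degree W Y j n w)%:R + delta) / S n.
  by move=> Bw; rewrite /attach_prob/= atom_weight// ltnW.
pose f w : R := (degree W Y i n w)%:R + delta.
have mf1 : discrete_fun f.
  by apply: (discrete_fun_factor (discrete_degree W Y i n)) => w w' h; rewrite /f h.
have f0 w : B w -> (0 <= (f w)%:E)%E by move=> Bw; rewrite lee_fin d0.
have mY e : measurable [set w | Y n.+1 e w = i] by exact: (discrete_rv _ [set i]).
have Ye e : (e < m)%N -> (\int[P]_(w in B) (\1_[set w | Y n.+1 e w = i] w)%:E =
    (S n)^-1%:E * \int[P]_(w in B) (f w)%:E)%E.
  move=> em; rewrite integral_indic// setIC.
  apply: (etrans (attach_measure hG n0 mB (@init_atom_history n t w0) BW _ _ em i_n)).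
  - by move=> w j Bw jn; rewrite pE// divr_ge0 ?d0// ltW.
  - move=> w Bw; under eq_bigr do rewrite pE//.
    by rewrite -mulr_suml atom_weight ?(ltnW nt)// mulfV// gt_eqF.
  - rewrite -ge0_integralZl_EFin//; last by rewrite invr_ge0 ltW.
      by apply: eq_integral => w; rewrite inE => Bw; rewrite pE// mulrC EFinM.
    exact: measurable_EFin_discrete.
rewrite (eq_integral (fun w => (f w)%:E +
    \sum_(e <- iota 0 m) (\1_[set w | Y n.+1 e w = i] w)%:E)%E); last first.
  move=> w; rewrite inE => Bw; rewrite degreeS sumEFin -EFinD; congr EFin.
  rewrite BW// ltn_eqF ?ltnS// mul0n add0n natrD addrAC; congr (_ + _).
  rewrite -sum1_count natr_sum big_mkcond/=; apply: eq_bigr => e _.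
  rewrite indicE; case: eqP => h; first by rewrite mem_set.
  by rewrite memNset.
rewrite ge0_integralD//; first last.
- apply: emeasurable_sum => e; apply: measurable_funTS.
  by apply/measurable_EFinP; exact: measurable_indic.
- by move=> w Bw; rewrite sume_ge0.
- exact: measurable_EFin_discrete.
rewrite ge0_integral_sum//; last first.
  by move=> e; apply: measurable_funTS; apply/measurable_EFinP; exact: measurable_indic.
rewrite big_seq (eq_bigr (fun _ => (S n)^-1%:E * \int[P]_(w in B) (f w)%:E)%E); last first.
  by move=> e; rewrite mem_iota add0n /= => /Ye.
rewrite -big_seq sume_const size_iota EFinD ge0_muleDl ?lee_fin ?divr_ge0 ?(ltW Sn0)// mul1e.
by rewrite muleA -EFinM.
Qed.

(** Divided by [S n], the integral is nonincreasing in [n], by [atom_degreeS] and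
    [weightS]. *)
Lemma atom_mean i n : (maxn i 1 <= n <= t)%N ->
  (\int[P]_(w in B) ((degree W Y i n w)%:R + delta)%:E <=
   (((W (maxn i 1) w0)%:R + delta) * (S n / S (maxn i 1)) * fine (P B))%:E)%E.
Proof.
set k := maxn i 1 => /andP[kn nt].
have k0 : (0 < k)%N by rewrite leq_max orbT.
have kt := leq_trans kn nt.
have mB : measurable B := measurable_init_atom t w0.
have Sk0 : 0 < S k by rewrite weight_gt0// k0.
have Wk : 0 <= (W k w0)%:R + delta by rewrite (le_trans (ltW kappa0))// good// k0.
elim: n kn nt => [|n IH]; first by rewrite leqn0 gtn_eqF.
rewrite leq_eqVlt ltnS => /predU1P[<- _|kn nt].
  rewrite (eq_integral (cst ((W k w0)%:R + delta)%:E)); last first.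
    move=> w; rewrite inE => Bw; congr (_%:R + _)%:E; rewrite -Bw ?k0//.
    have old s e : (0 < s)%N -> (e < W s w)%N -> (Y s e w < s)%N by exact: (parid_old hG).
    exact: degree_birth.
  rewrite integral_cst// divff ?gt_eqF// mulr1 EFinM fineK//.
  exact: fin_num_measure.
have n0 : (0 < n)%N := leq_trans k0 kn.
have i_n : (i <= n)%N by apply: leq_trans kn; rewrite leq_maxl.
have Sn0 : 0 < S n by rewrite weight_gt0// n0 ltnW.
rewrite atom_degreeS ?n0//.
have c0 : 0 <= 1 + (W n.+1 w0)%:R / S n by rewrite addr_ge0// divr_ge0// ltW.
apply: (@le_trans _ _ ((1 + (W n.+1 w0)%:R / S n)%:E *
    (((W k w0)%:R + delta) * (S n / S k) * fine (P B))%:E)%E).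
  by rewrite lee_wpmul2l ?lee_fin// IH// ltnW.
rewrite -EFinM lee_fin.
rewrite [leLHS](_ : _ = ((W k w0)%:R + delta) * ((S n + (W n.+1 w0)%:R) / S k) * fine (P B)); last first.
  by field; rewrite !gt_eqF.
rewrite ler_wpM2r ?fine_ge0// ler_wpM2l// ler_wpM2r ?invr_ge0 ?(ltW Sk0)//.
exact: weightS.
Qed.

(** Jensen's inequality on the atom: the tangent is taken at the bound on the
    conditional mean of the shifted degree. *)
Lemma atom_power (s : R) i : 0 < s < 1 -> (maxn i 1 <= t)%N ->
  (\int[P]_(w in B) ((degree W Y i t w)%:R `^ s)%:E <=
   ((Kd * (((W (maxn i 1) w0)%:R + delta) * (S t / S (maxn i 1)))) `^ s * fine (P B))%:E)%E.
Proof.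
move=> s01; have /andP[s0 s1] := s01; set k := maxn i 1 => kt.
have k0 : (0 < k)%N by rewrite leq_max orbT.
have t0 := leq_trans k0 kt.
have mB : measurable B := measurable_init_atom t w0.
set z := _ * (S t / _).
have Sk0 : 0 < S k by rewrite weight_gt0// k0.
have St0 : 0 < S t by rewrite weight_gt0// t0 leqnn.
have z0 : 0 < z by rewrite mulr_gt0 ?divr_gt0// (lt_le_trans kappa0)// good// k0.
have Kd0 : 0 < Kd by rewrite (lt_le_trans _ Kd1).
pose f w : R := (degree W Y i t w)%:R + delta.
have fk w : B w -> kappa <= f w by move=> Bw; rewrite atom_degree_lb// kt leqnn.
have f0 w : B w -> 0 <= f w by move=> Bw; rewrite (le_trans (ltW kappa0))// fk.
have mf (h : R -> R) : discrete_fun (fun w => h (f w)).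
  by apply: (discrete_fun_factor (discrete_degree W Y i t)) => w w' e; rewrite /f e.
have s1' : 0 <= 1 - s by rewrite subr_ge0 ltW.
pose a : R := (1 - s) * z `^ s; pose b : R := s * z `^ (s - 1).
have a0 : 0 <= a by rewrite mulr_ge0 ?powR_ge0.
have b0 : 0 <= b by rewrite mulr_ge0 ?powR_ge0// ltW.
rewrite powRM ?(ltW z0) ?(ltW Kd0)// -mulrA.
apply: (integral_leM (g := fun w => a + b * f w)) => //.
- by apply: (discrete_fun_factor (discrete_degree W Y i t)) => w w' ->.
- exact: (mf (fun x => a + b * x)).
- move=> w Bw; rewrite powR_ge0/=.
  apply: (@le_trans _ _ ((Kd * f w) `^ s)).
    by apply: powR_le; [exact: ltW|by []|apply: le_shift; exact: fk].
  rewrite powRM ?f0 ?(ltW Kd0)// ler_wpM2l ?powR_ge0//.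
  by rewrite powR_tangent// f0.
- by move=> w Bw; rewrite addr_ge0// mulr_ge0// f0.
- exact: powR_ge0.
under eq_integral do rewrite EFinD (EFinM b).
rewrite ge0_integralD//; first last.
- under eq_fun do rewrite -EFinM.
  by apply: measurable_EFin_discrete; exact: (mf (fun x => b * x)).
- by move=> w Bw; rewrite -EFinM lee_fin mulr_ge0// f0.
rewrite integral_cst// ge0_integralZl_EFin//; first last.
- by apply: measurable_EFin_discrete; exact: (mf id).
apply: (@le_trans _ _ (a%:E * (fine (P B))%:E + b%:E * (z * fine (P B))%:E)%E).
  rewrite fineK ?fin_num_measure// leeD2l// lee_wpmul2l ?lee_fin//.
  by apply: atom_mean; rewrite kt leqnn.
rewrite -!EFinM -EFinD lee_fin le_eqVlt; apply/orP; left; apply/eqP.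
rewrite /a /b -[in RHS](mulr_powRB1 (ltW z0) s0) -[in LHS](mulr_powRB1 (ltW z0) s0); ring.
Qed.

Lemma weight_ratio_le i : (maxn i 1 <= t)%N ->
  ((W (maxn i 1) w0)%:R + delta) * (S t / S (maxn i 1)) <=
  ((1 + `|delta|) * (2 + 2 * `|delta|) * Kd) * ((W (maxn i 1) w0)%:R * L t / L (maxn i 1)).
Proof.
set k := maxn i 1 => kt; have k0 : (0 < k)%N by rewrite leq_max orbT.
have t0 := leq_trans k0 kt.
have Sk0 : 0 < S k by rewrite weight_gt0// k0.
have St0 : 0 < S t by rewrite weight_gt0// t0 leqnn.
have Lk0 : 0 < L k by apply: lt_le_trans (num_edges_ge k); rewrite ltr0n.
have Wk : 0 <= (W k w0)%:R + delta by rewrite (le_trans (ltW kappa0))// good// k0.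
rewrite [leRHS](_ : _ = ((1 + `|delta|) * (W k w0)%:R) *
   (((2 + 2 * `|delta|) * L t) * (Kd / L k))); last by ring.
apply: ler_pM => //; first by rewrite divr_ge0// ltW.
  rewrite mulrDl mul1r lerD2l (le_trans (ler_norm _))// ler_peMr// ler1n.
  exact: (parid_pos hG).
apply: ler_pM; rewrite ?invr_ge0 ?(ltW Sk0) ?(ltW St0) ?weight_le//.
rewrite -div1r ler_pdivrMr// mulrAC ler_pdivlMr// mul1r.
by rewrite num_edges_le_weight// k0.
Qed.

End GoodAtom.

Let scale : R := (1 + `|delta| / kappa) *
  ((1 + `|delta|) * (2 + 2 * `|delta|) * (1 + `|delta| / kappa)).

Lemma atom_degree_moment (s : R) i t w0 : 0 < s < 1 -> (maxn i 1 <= t)%N ->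
  (\int[P]_(w in init_atom t w0) ((degree W Y i t w)%:R `^ s)%:E <=
   \int[P]_(w in init_atom t w0) (scale `^ s * ((W (maxn i 1) w)%:R *
     (num_edges W w t)%:R / (num_edges W w (maxn i 1))%:R) `^ s)%:E)%E.
Proof.
move=> s01 kt; have mB := measurable_init_atom t w0.
have k0 : (0 < maxn i 1)%N by rewrite leq_max orbT.
have [good|bad] := pselect (forall j, (0 < j <= t)%N -> kappa <= (W j w0)%:R + delta).
  apply: (le_trans (atom_power good s01 kt)).
  set c := (W (maxn i 1) w0)%:R * (num_edges W w0 t)%:R / (num_edges W w0 (maxn i 1))%:R : R.
  rewrite (eq_integral (cst (scale `^ s * c `^ s)%:E)); last first.
    move=> w; rewrite inE => Bw; rewrite Bw ?k0//.
    have LE n : (n <= t)%N -> num_edges W w n = num_edges W w0 n.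
      move=> nt; apply: eq_num_edges => j /andP[j0 jn].
      by rewrite Bw// j0 (leq_trans jn).
    by rewrite !LE.
  rewrite integral_cst// -[X in (_ <= _ * X)%E]fineK ?fin_num_measure// -EFinM lee_fin.
  have sc0 : 0 <= scale by rewrite !mulr_ge0// ?addr_ge0 ?divr_ge0// ltW.
  have c0 : 0 <= c by rewrite divr_ge0.
  rewrite ler_wpM2r ?fine_ge0// -powRM//; apply: powR_le.
  - by case/andP: s01 => /ltW.
  - rewrite mulr_ge0// ?addr_ge0 ?divr_ge0 ?(ltW kappa0)// mulr_ge0//.
      by rewrite (le_trans (ltW kappa0))// good// k0.
    by apply: divr_ge0; apply: ltW; apply: (weight_gt0 good);
      rewrite ?leqnn ?k0 ?(leq_trans k0).
  - rewrite [leRHS](_ : _ = (1 + `|delta| / kappa) * ((1 + `|delta|) *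
      (2 + 2 * `|delta|) * (1 + `|delta| / kappa) * c)); last exact/esym/mulrA.
    apply: ler_wpM2l; first by rewrite addr_ge0// divr_ge0// ltW.
    exact: (weight_ratio_le good).
have PB0 : P (init_atom t w0) = 0%E.
  move/existsNP : bad => [j /not_implyP[jt /negP]]; rewrite -ltNge => bad.
  apply/eqP; rewrite eq_le measure_ge0 andbT.
  have /andP[j0 _] := jt.
  rewrite -(init_degree_below_support j0 bad); apply: le_measure; rewrite ?inE//.
    exact: (discrete_rv (W j) [set W j w0]).
  by move=> w /(_ j jt).
rewrite null_set_integral//; last first.
  apply: measurable_EFin_discrete.
  by apply: (discrete_fun_factor (discrete_degree W Y i t)) => w w' ->.
by apply: integral_ge0 => w _; rewrite lee_fin mulr_ge0 ?powR_ge0.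
Qed.

Lemma discrete_init (U : Type) t (f : T -> U) :
  (forall w w', (forall j, (0 < j <= t)%N -> W j w = W j w') -> f w = f w') ->
  discrete_fun f.
Proof.
move=> Hf; apply: (discrete_fun_factor (@discrete_seq _ _ _ _ (fun j => W j) (iota 1 t)
  (fun j => discrete_rv (W j)))) => w w' e; apply: Hf => j /andP[j0 jt].
have := congr1 (fun s => nth 0%N s j.-1) e.
rewrite !(nth_map 0%N) ?size_iota ?nth_iota ?prednK//.
  by rewrite add1n prednK.
Qed.

(** Sum over the atoms, which are the level sets of the integer coding
    (W_1, ..., W_t). *)
Lemma degree_moment (s : R) : 0 < s < 1 -> exists2 K : R, 0 < K &
  forall i t, (maxn i 1 <= t)%N ->
  (\int[P]_w ((degree W Y i t w)%:R `^ s)%:E <=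
   K%:E * \int[P]_w (((W (maxn i 1) w)%:R *
     (num_edges W w t)%:R / (num_edges W w (maxn i 1))%:R) `^ s)%:E)%E.
Proof.
move=> s01; have kd0 : 0 <= `|delta| / kappa by rewrite divr_ge0// ltW.
have sc0 : 0 < scale.
  have n0 : 0 <= `|delta| by [].
  by rewrite /scale !mulr_gt0//; lra.
exists (scale `^ s) => [|i t kt]; first by rewrite powR_gt0.
pose r w : R := ((W (maxn i 1) w)%:R *
  (num_edges W w t)%:R / (num_edges W w (maxn i 1))%:R) `^ s.
have LE n w w' : (n <= t)%N -> (forall j, (0 < j <= t)%N -> W j w = W j w') ->
    num_edges W w n = num_edges W w' n.
  move=> nt H; apply: eq_num_edges => j /andP[j0 jn].
  by rewrite H// j0 (leq_trans jn).
have mr : discrete_fun r.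
  apply: (discrete_init (t := t)) => w w' H.
  by rewrite /r H ?kt ?leq_max ?orbT// !(LE _ w w').
have mg : discrete_fun (fun w => scale `^ s * r w) by exact: (discrete_comp ( *%R _)).
have mf : discrete_fun (fun w => (degree W Y i t w)%:R `^ s : R).
  by apply: (discrete_fun_factor (discrete_degree W Y i t)) => w w' ->.
rewrite -ge0_integralZl_EFin//; last 2 first.
- exact: measurable_EFin_discrete.
- exact: powR_ge0.
under [leRHS]eq_integral do rewrite -EFinM.
pose V w := pickle [seq W j w | j <- iota 1 t].
have mV : discrete_fun V.
  by apply: (discrete_comp pickle); apply: discrete_seq => j; exact: discrete_rv.
pose F n := V @^-1` [set n].
have UF : \bigcup_n F n = setT by apply/seteqP; split => // w _; exists (V w).
have tF : trivIset setT F.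
  by apply/trivIsetP => m n _ _ /eqP mn; apply/seteqP; split => // w [/= e1 e2];
    apply: mn; rewrite -e1 -e2.
rewrite -UF !ge0_integral_bigcup//; first last.
- by rewrite UF; exact: measurable_EFin_discrete.
- by move=> k; exact: mV.
- by move=> w _; rewrite lee_fin mulr_ge0 ?powR_ge0.
- by rewrite UF; exact: measurable_EFin_discrete.
- by move=> k; exact: mV.
apply: lee_nneseries => [n _|n _]; first by rewrite integral_ge0.
have [->|/set0P[w0 w0n]] := eqVneq (F n) set0; first by rewrite !integral_set0.
suff -> : F n = init_atom t w0 by exact: atom_degree_moment.
rewrite -w0n; apply/seteqP; split => w.
  move=> /= /(pcan_inj pickleK_inv) e j jt; have /andP[j0 _] := jt.
  have := congr1 (fun s => nth 0%N s j.-1) e.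
  by rewrite !(nth_map 0%N) ?size_iota ?nth_iota ?prednK ?add1n ?prednK//; case/andP: jt.
move=> H; congr pickle; apply/eq_in_map => j; rewrite mem_iota add1n ltnS; exact: H.
Qed.

End Atoms.

(** * Ratios of sums of initial degrees *)

Section InitialDegrees.
Context (d : measure_display) (T : measurableType d) (R : realType).
Variables (P : probability T R) (W : nat -> {RV P >-> nat}) (F : R -> R) (s : R).
Hypotheses (Windep : mutually_independent P [set i | (1 <= i)%N] W)
  (Wtail : forall j, (0 < j)%N -> has_tail P F (W j))
  (Fpos : forall x : R, 0 <= x -> 0 < F x)
  (Fmono : forall x y : R, 0 <= x -> x <= y -> F y <= F x)
  (s0 : 0 < s) (s1 : s < 1).

Lemma tail_le1 (x : R) : 0 <= x -> F x <= 1.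
Proof.
move=> x0; have [mW tW] := Wtail (leqnn 1).
rewrite -lee_fin -tW//; apply: probability_le1.
exact: (measurable_discrete_pred (fun n : nat => x < n%:R) mW).
Qed.

Lemma prob_le_tail j (x : R) : (0 < j)%N -> 0 <= x ->
  P (W j @^-1` [set n | n%:R <= x]) = (1 - F x)%:E.
Proof.
move=> j0 x0; have [mW tW] := Wtail j0.
rewrite (_ : _ @^-1` _ = ~` [set w | x < (W j w)%:R]).
  rewrite probability_setC.
    by rewrite EFinB -tW.
  exact: (measurable_discrete_pred (fun n : nat => x < n%:R) mW).
by apply/seteqP; split => w /=; rewrite leNgt => /negP.
Qed.

Lemma indep_pair k j n l : (0 < k < j)%N ->
  P ((W k @^-1` [set n]) `&` (W j @^-1` [set l])) =
  (P (W k @^-1` [set n]) * P (W j @^-1` [set l]))%E.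
Proof.
move=> /andP[k0 kj]; have j0 := ltn_trans k0 kj.
pose A i : set nat := if i == k then [set n] else [set l].
have := Windep (J := [:: k; j]) (A := A); rewrite !big_cons big_nil mule1.
rewrite /A eqxx gtn_eqF// => <-//; last 2 first.
- by rewrite /= inE ltn_eqF.
- by move=> i; rewrite !inE => /orP[] /eqP ->.
congr (P _); apply/seteqP; split => [w [wk wj] i /=|w H].
  by rewrite !inE => /orP[] /eqP ->; rewrite ?eqxx// gtn_eqF.
split; first by have := H k; rewrite /= !inE eqxx; apply.
by have := H j; rewrite /= !inE eqxx gtn_eqF// orbT; apply.
Qed.

Lemma indep_past k j n l (x : R) : (0 < k < j)%N -> 0 <= x ->
  P ((W k @^-1` [set n]) `&` (W j @^-1` [set l]) `&`
     [set w | forall i, (0 < i < k)%N -> (W i w)%:R <= x]) =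
  (P (W k @^-1` [set n]) * P (W j @^-1` [set l]) * ((1 - F x) ^+ k.-1)%:E)%E.
Proof.
move=> /andP[k0 kj] x0; have j0 := ltn_trans k0 kj.
pose A i : set nat := if i == k then [set n] else if i == j then [set l]
  else [set m | m%:R <= x].
pose J := [:: k, j & iota 1 k.-1].
have iJ i : (i \in iota 1 k.-1) = (0 < i < k)%N by rewrite mem_iota add1n prednK.
have AE i : (0 < i < k)%N -> A i = [set m | m%:R <= x].
  by move=> /andP[i0 ik]; rewrite /A !ltn_eqF// (ltn_trans ik).
have Ak : A k = [set n] by rewrite /A eqxx.
have Aj : A j = [set l] by rewrite /A gtn_eqF// eqxx.
have := Windep (J := J) (A := A); rewrite !big_cons muleA Ak Aj.
have -> : (\prod_(i <- iota 1 k.-1) P (W i @^-1` A i) = ((1 - F x) ^+ k.-1)%:E)%E.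
  rewrite big_seq (eq_bigr (fun=> (1 - F x)%:E)); last first.
    by move=> i; rewrite iJ => ik; rewrite AE// prob_le_tail//; case/andP: ik.
  rewrite -big_seq -[in RHS](size_iota 1 k.-1).
  elim: (iota 1 k.-1) => [|y r IH]; first by rewrite big_nil.
  by rewrite big_cons IH/= exprS.
move=> <-//; last 2 first.
- rewrite /J /= !inE negb_or ltn_eqF//= iota_uniq andbT !iJ ltnn andbF/=.
  by rewrite (ltnNge j) (ltnW kj) andbF.
- by move=> i; rewrite !inE iJ => /or3P[/eqP ->|/eqP ->|/andP[]].
congr (P _); apply/seteqP; split => [w [[wk wj] wi] i /=|w H].
  rewrite !inE iJ => /or3P[/eqP ->|/eqP ->|ik]; rewrite ?Ak ?Aj ?AE//; exact: wi.
split; first split.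
- by have := H k; rewrite /= !inE eqxx Ak; apply.
- by have := H j; rewrite /= !inE eqxx orbT Aj; apply.
- by move=> i ik; have := H i; rewrite /= !inE iJ ik !orbT AE//; apply.
Qed.

(** The maximum with 1 keeps negative powers meaningful when [k = 1]. *)
Definition past_size k w : R := Num.max 1 (num_edges W w k.-1)%:R.

Lemma discrete_past_size k : discrete_fun (past_size k).
Proof.
apply: (discrete_init (W := W) (t := k.-1)) => w w' H.
by rewrite /past_size (eq_num_edges H).
Qed.

Variables (a : R -> nat) (xmin q1 q2 : R).
Hypotheses (Ha : tail_quantile F a) (x01 : 1 <= xmin) (q1h : 1 < 2 * q1)
  (q2h : 2 `^ s * q2 < 1)
  (doubling : forall x : R, xmin <= x -> q1 * F x <= F (2 * x) <= q2 * F x).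

(** Split off W_j, then W_k, by [integral_comp_le]; what remains is a negative
    moment of the past on the event that W_k and W_j have given values, where
    independence of the past enters through [indep_past] only. *)
Lemma decoupling : exists2 D, 0 < D & forall k j (u : nat -> R), (0 < k < j)%N ->
  (forall n, 0 <= u n) ->
  (\int[P]_w (u (W j w) * ((W k w)%:R `^ s * past_size k w `^ (- s)))%:E <=
   (D * (a k%:R)%:R `^ (- s))%:E * \int[P]_w (u (W j w))%:E)%E.
Proof.
have [C1 C10 HC1] := power_moment P Fpos Fmono s0 s1 x01 q1h q2h doubling.
have [K K0 HK] := negative_moment P Fpos s0 x01 q2h doubling.
exists (C1 * K) => [|k j u kj u0]; first exact: mulr_gt0.
rewrite -[C1 * K * _]mulrA; have /andP[k0 kj'] := kj; have j0 := ltn_trans k0 kj'.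
have k0R : (0 : R) < k%:R by rewrite ltr0n.
have [ak1 _ ak] := Ha k0R.
have A0 : 0 <= K * (a k%:R)%:R `^ (- s) by rewrite mulr_ge0 ?powR_ge0// ltW.
have mMs : discrete_fun (fun w => past_size k w `^ (- s)).
  exact: (discrete_comp (fun y : R => y `^ (- s)) (@discrete_past_size k)).
have mWj := discrete_rv (W j); have mWk := discrete_rv (W k).
have fineP (X : set T) : measurable X -> P X = (fine (P X))%:E.
  by move=> mX; rewrite fineK// fin_num_measure.
have mg : discrete_fun (fun w => (W k w)%:R `^ s * past_size k w `^ (- s)).
  exact: (discrete_glue (f := fun v w => (v%:R : R) `^ s * past_size k w `^ (- s)) mWk
    (fun v => discrete_comp ( *%R (v%:R `^ s)) mMs)).
apply: integral_comp_le => //.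
- by move=> w; rewrite mulr_ge0 ?powR_ge0.
- by rewrite mulr_ge0// ltW.
move=> l; rewrite setTI; set Bl := W j @^-1` [set l]; have mBl : measurable Bl := mWj [set l].
have HD : (\int[P]_(w in Bl) ((W k w)%:R `^ s * past_size k w `^ (- s))%:E <=
    (K * (a k%:R)%:R `^ (- s) * fine (P Bl))%:E * \int[P]_w ((W k w)%:R `^ s)%:E)%E.
  apply: (integral_comp_le (u := fun n : nat => (n%:R : R) `^ s)) => //.
  - by move=> n; exact: powR_ge0.
  - by rewrite mulr_ge0 ?fine_ge0.
  move=> n; set Bk := W k @^-1` [set n]; have mBk : measurable Bk := mWk [set n].
  pose c : R := fine (P Bk) * fine (P Bl).
  have c0 : 0 <= c by rewrite mulr_ge0 ?fine_ge0.
  have cE : (P Bk * P Bl)%E = c%:E.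
    by rewrite (fineP Bk mBk) (fineP Bl mBl) -EFinM.
  have -> : ((K * (a k%:R)%:R `^ (- s) * fine (P Bl))%:E * P Bk)%E =
      (K * ((a k%:R)%:R `^ (- s) * c))%:E.
    by rewrite [in LHS](fineP Bk mBk) -EFinM; congr EFin; rewrite /c; ring.
  apply: (HK (past_size k) (Bl `&` Bk) c k%:R) => //.
  - exact: discrete_past_size.
  - exact: measurableI.
  - by move=> w; rewrite le_max lexx.
  - rewrite setIC -cE le_eqVlt; apply/orP; left; apply/eqP; exact: indep_pair.
  - move=> x x1; have x0 : 0 <= x by apply: le_trans x1.
    apply: (@le_trans _ _ (P (Bk `&` Bl `&`
        [set w | forall i, (0 < i < k)%N -> (W i w)%:R <= x]))).
      apply: le_measure; rewrite ?inE.
      + apply: measurableI; first exact: measurableI.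
        exact: (measurable_discrete_pred (fun y : R => y <= x) (@discrete_past_size k)).
      + apply: measurableI; first exact: measurableI.
        rewrite (_ : [set w | _] = \bigcap_(i in [set i | (0 < i < k)%N])
            [set w | (W i w)%:R <= x])//.
        apply: bigcap_measurableType => i _.
        exact: (measurable_discrete_pred (fun n : nat => n%:R <= x) (discrete_rv (W i))).
      + move=> w [[wl wk] /= Mx]; split => // i /andP[i0 ik].
        apply: le_trans Mx; rewrite le_max; apply/orP; right; rewrite ler_nat.
        by rewrite init_degree_le_num_edges// i0/= -ltnS prednK.
    have -> := indep_past n l kj x0.
    rewrite cE -EFinM lee_fin ler_wpM2l//.
    rewrite -[k in k%:R](prednK k0); apply: bernoulli_inv.
    by rewrite Fpos ?tail_le1.
  - by rewrite ltr0n.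
  - move=> x /andP[x1 xa]; rewrite leNgt; apply/negP => kF.
    by have := ak x x1 (ltW kF); rewrite leNgt xa.
apply: (le_trans HD); rewrite [in leRHS](fineP Bl mBl) -EFinM.
rewrite -(mulrA C1) (mulrC C1) (EFinM _ C1).
apply: lee_wpmul2l; first by rewrite lee_fin mulr_ge0 ?fine_ge0.
by apply: HC1; exact: Wtail.
Qed.

Hypothesis Wpos : forall j w, (0 < j)%N -> (0 < W j w)%N.

(** L_t = L_k + b D, where D is the sum of the W_j / b with k < j <= t; the
    denominator L_k is bounded below by the part that is independent of W_k. *)
Lemma ratio_pointwise k t (b : R) w : (0 < k <= t)%N -> 0 < b ->
  ((W k w)%:R * (num_edges W w t)%:R / (num_edges W w k)%:R) `^ s <=
  (W k w)%:R `^ s + b `^ s * ((W k w)%:R `^ s * past_size k w `^ (- s) +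
    \sum_(j <- index_iota k.+1 t.+1) trunc_pow s ((W j w)%:R / b) *
      ((W k w)%:R `^ s * past_size k w `^ (- s))).
Proof.
move=> /andP[k0 kt] b0; have s01 : 0 < s <= 1 by rewrite s0 ltW.
have Wk1 := Wpos w k0.
have WLk : (W k w <= num_edges W w k)%N by rewrite init_degree_le_num_edges// k0 leqnn.
have Lk0 : (0 : R) < (num_edges W w k)%:R by rewrite ltr0n (leq_trans Wk1).
have M0 : 0 < past_size k w by rewrite lt_max ltr01.
have ML : past_size k w <= (num_edges W w k)%:R.
  rewrite ge_max ler1n (leq_trans Wk1)//= ler_nat.
  by rewrite -[in leqRHS](prednK k0) num_edgesS leq_addr.
pose D : R := \sum_(j <- index_iota k.+1 t.+1) (W j w)%:R / b.
have D0 : 0 <= D by apply: sumr_ge0 => j _; rewrite divr_ge0// ltW.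
have -> : (W k w)%:R * (num_edges W w t)%:R / (num_edges W w k)%:R =
    (W k w)%:R + (W k w)%:R / (num_edges W w k)%:R * (b * D) :> R.
  have -> : num_edges W w t =
      (num_edges W w k + \sum_(k.+1 <= j < t.+1) W j w)%N.
    by rewrite /num_edges -big_cat_nat.
  rewrite natrD natr_sum /D -mulr_suml; field; rewrite !gt_eqF//.
rewrite (le_trans (powR_subadd s01 _ _)) ?mulr_ge0 ?invr_ge0 ?(ltW b0)//.
rewrite lerD2l !powRM ?mulr_ge0 ?invr_ge0 ?(ltW b0)// mulrCA ler_wpM2l ?powR_ge0//.
rewrite -mulr_suml -[X in _ <= X + _]mul1r -mulrDl mulrC.
apply: ler_pM; rewrite ?mulr_ge0 ?powR_ge0//.
  by apply: powR_sum_trunc => // j; rewrite divr_ge0// ltW.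
rewrite ler_wpM2l ?powR_ge0// powRV// -powRN powRN_le// ltW//.
Qed.

(** Take [b = a t] in [ratio_pointwise]: each later W_j contributes O(F (a t)),
    and there are at most [t] of them.  The isolated term W_k^s is absorbed since
    [a] is monotone. *)
Lemma ratio_moment : exists2 C, 0 < C & forall k t, (0 < k <= t)%N ->
  (\int[P]_w (((W k w)%:R * (num_edges W w t)%:R / (num_edges W w k)%:R) `^ s)%:E <=
   (C * ((a t%:R)%:R / (a k%:R)%:R) `^ s)%:E)%E.
Proof.
have [C1 C10 HC1] := power_moment P Fpos Fmono s0 s1 x01 q1h q2h doubling.
have [C2 C20 HC2] := trunc_pow_moment P Fpos Fmono s0 s1 x01 q1h q2h doubling.
have [D D0 HD] := decoupling.
exists (C1 + D * (1 + C2)) => [|k t kt].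
  by rewrite addr_gt0// mulr_gt0// addr_gt0. have /andP[k0 kt'] := kt; have t0 := leq_trans k0 kt'.
have t0R : (0 : R) < t%:R by rewrite ltr0n.
have k0R : (0 : R) < k%:R by rewrite ltr0n.
have [at1 Fat _] := Ha t0R; have [ak1 _ _] := Ha k0R.
set b : R := (a t%:R)%:R in Fat *; have b1 : 1 <= b by rewrite ler1n.
have b0 : 0 < b by apply: lt_le_trans b1.
have Fb : 0 < F b by rewrite Fpos// ltW.
set Q : R := D * (a k%:R)%:R `^ (- s).
have Q0 : 0 <= Q by rewrite mulr_ge0 ?powR_ge0// ltW.
have r1 : 1 <= (b / (a k%:R)%:R) `^ s.
  rewrite -[leLHS](one_powR s) powR_le ?(ltW s0)// ler_pdivlMr ?ltr0n// mul1r ler_nat.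
  by apply: (tail_quantile_homo Fpos Ha); rewrite ?ler_nat.
pose h w : R := (W k w)%:R `^ s * past_size k w `^ (- s).
have h0 w : 0 <= h w by rewrite mulr_ge0 ?powR_ge0.
pose r := index_iota k.+1 t.+1.
pose phi j w : R := trunc_pow s ((W j w)%:R / b).
have phi0 j w : 0 <= phi j w by rewrite trunc_pow_ge0// divr_ge0// ltW.
have hE w w' : (forall i, (0 < i <= t)%N -> W i w = W i w') -> h w = h w'.
  move=> H; rewrite /h /past_size H ?k0// (eq_num_edges (k := k.-1) (w := w) (w' := w'))// => i /andP[i0 ik].
  by rewrite H// i0 (leq_trans ik)// (leq_trans (leq_pred _)).
have mh : discrete_fun h by apply: (discrete_init (W := W) (t := t)).
have mphih j : discrete_fun (fun w => phi j w * h w).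
  exact: (discrete_glue (f := fun v w => trunc_pow s ((v%:R : R) / b) * h w)
    (discrete_rv (W j)) (fun v => discrete_comp ( *%R (trunc_pow s (v%:R / b))) mh)).
have Hh : (\int[P]_w (h w)%:E <= Q%:E)%E.
  (* any index above k will do, the function of it being constant *)
  have := HD k k.+1 (fun=> 1); rewrite k0 ltnSn => /(_ isT (fun=> ler01)).
  have -> : (\int[P]_(w in setT) 1%:E = 1)%E.
    by rewrite (integral_cst P measurableT) mul1e; exact: probability_setT.
  rewrite mule1; by under eq_integral do rewrite mul1r.
have Hphi j : j \in r -> (\int[P]_w (phi j w * h w)%:E <= (Q * (C2 * F b))%:E)%E.
  rewrite mem_index_iota => /andP[kj jt].
  apply: (le_trans (HD k j (fun n => trunc_pow s (n%:R / b)) _ _)).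
  - by rewrite k0.
  - by move=> n; rewrite trunc_pow_ge0// divr_ge0// ltW.
  rewrite -/Q (EFinM Q) lee_wpmul2l ?lee_fin//.
  by apply: HC2 => //; apply: Wtail; rewrite (leq_trans _ kj).
have HG : (\int[P]_w ((h w)%:E + \sum_(j <- r) (phi j w * h w)%:E) <=
    (Q * (1 + C2))%:E)%E.
  rewrite ge0_integralD//; first last.
  - by apply: emeasurable_sum => j; exact: measurable_EFin_discrete.
  - by move=> w _; apply: sume_ge0 => j _; rewrite lee_fin mulr_ge0.
  - exact: measurable_EFin_discrete.
  - by move=> w _; rewrite lee_fin.
  rewrite ge0_integral_sum//; first last.
  - by move=> j w _; rewrite lee_fin mulr_ge0.
  - by move=> j; exact: measurable_EFin_discrete.
  rewrite mulrDr mulr1 EFinD leeD//.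
  apply: (@le_trans _ _ (\sum_(j <- r) (Q * (C2 * F b))%:E)%E).
    by rewrite big_seq [leRHS]big_seq; apply: lee_sum => j; exact: Hphi.
  rewrite sume_const -EFinM lee_fin /r size_iota mulrCA ler_wpM2l//.
  rewrite mulrCA -[leRHS]mulr1 ler_pM2l// (le_trans _ Fat)// ler_wpM2r ?(ltW Fb)//.
  by rewrite ler_nat subSS leq_subr.
have bs0 : 0 <= b `^ s by exact: powR_ge0.
have mWk : measurable_fun setT (fun w => ((W k w)%:R `^ s)%:E).
  apply: measurable_EFin_discrete.
  exact: (discrete_comp (fun n : nat => (n%:R : R) `^ s) (discrete_rv (W k))).
have mG : measurable_fun setT (fun w => (h w)%:E + \sum_(j <- r) (phi j w * h w)%:E)%E.
  apply: emeasurable_funD; first exact: measurable_EFin_discrete.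
  by apply: emeasurable_sum => j; exact: measurable_EFin_discrete.
have G0 w : (0 <= (h w)%:E + \sum_(j <- r) (phi j w * h w)%:E)%E.
  apply: adde_ge0; rewrite ?lee_fin//.
  by apply: sume_ge0 => j _; rewrite lee_fin mulr_ge0.
apply: (@le_trans _ _ (\int[P]_w (((W k w)%:R `^ s)%:E +
    (b `^ s)%:E * ((h w)%:E + \sum_(j <- r) (phi j w * h w)%:E)))%E).
  apply: ge0_le_integral => //.
  - apply: measurable_EFin_discrete; apply: (discrete_init (W := W) (t := t)) => w w' H.
    rewrite H ?k0// (eq_num_edges H) (eq_num_edges (k := k) (w := w) (w' := w'))// => i /andP[i0 ik].
    by rewrite H// i0 (leq_trans ik).
  - by apply: emeasurable_funD => //; exact: measurable_funeM.
  - move=> w _; rewrite sumEFin -(EFinD (h w)) -EFinM -EFinD lee_fin.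
    exact: ratio_pointwise.
rewrite ge0_integralD//; first last.
- exact: measurable_funeM.
- by move=> w _; apply: mule_ge0; rewrite ?lee_fin.
rewrite ge0_integralZl_EFin//.
apply: (@le_trans _ _ (C1%:E + (b `^ s)%:E * (Q * (1 + C2))%:E)%E).
  rewrite leeD//; first by apply: HC1; exact: Wtail.
  by rewrite lee_wpmul2l ?lee_fin.
rewrite -EFinM -EFinD lee_fin mulrDl lerD ?ler_peMr ?(ltW C10)//.
rewrite powR_div ?(ltW b0)// le_eqVlt; apply/orP; left; apply/eqP.
by rewrite /Q powRN; ring.
Qed.

End InitialDegrees.

(** * The moment bound *)

Unset Implicit Arguments.

Theorem theorem1p6 (d : measure_display) (T : measurableType d) (R : realType)
    (P : probability T R) (delta : R) (W : nat -> {RV P >-> nat})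
    (Y : nat -> nat -> {RV P >-> nat}) (hG : parid delta W Y)
    (tauW : R) (htau : 1 < tauW < 2) (L : R -> R) (hL : slowly_varying L)
    (htail : forall x : R, 0 < x ->
      P [set w | x < (W 1%N w)%:R] = (x `^ (1 - tauW) * L x)%:E)
    (s : R) (hs : 0 < s < tauW - 1) :
  exists (C : R) (l : R -> R),
    [/\ 0 < C, slowly_varying l, (forall x : R, 0 <= x -> 0 < l x) &
      forall t i : nat, (1 <= t)%N -> (i <= t)%N ->
        ('E_P[fun w => ((degree W Y i t w)%:R `^ s)%R] <=
         (C * (t%:R / (maxn i 1)%:R) `^ (s / (tauW - 1)) *
          (l t%:R / l i%:R) `^ s)%:E)%E].
Proof.
have /andP[tau1 tau2] := htau; have /andP[s0 st] := hs.
set alpha := tauW - 1 in hs st *.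
have alpha0 : 0 < alpha by rewrite subr_gt0.
have alpha1 : alpha < 1 by rewrite ltrBlDr.
have s1 : s < 1 by apply: lt_trans alpha1.
pose F (x : R) : R := fine (P [set w | x < (W 1 w)%:R]).
have mW (j : nat) (x : R) : measurable [set w | x < (W j w)%:R].
  exact: (measurable_discrete_pred (fun n : nat => x < n%:R) (discrete_rv (W j))).
have FE (x : R) : P [set w | x < (W 1 w)%:R] = (F x)%:E by rewrite fineK// fin_num_measure.
have FL (x : R) : 0 < x -> F x = x `^ (- alpha) * L x.
  by move=> x0; rewrite /F htail//= opprB.
have Fmono (x y : R) : 0 <= x -> x <= y -> F y <= F x.
  move=> _ xy; rewrite -lee_fin -!FE; apply: le_measure; rewrite ?inE//.
  by move=> w /=; apply: le_lt_trans.
have Fpos (x : R) : 0 <= x -> 0 < F x.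
  move=> x0; rewrite lt_neqAle fine_ge0// andbT; apply/negP => /eqP Fx0.
  have [M [_ HM]] := cvgr_gt _ (hL 2 (ltr0Sn _ 1)) 0 ltr01.
  pose y := `|M| + x + 1.
  have My : M < y by rewrite /y; have := ler_norm M; lra.
  have xy : x <= y by rewrite /y; have := normr_ge0 M; lra.
  have y0 : 0 < y by rewrite /y; have := normr_ge0 M; lra.
  (* a zero of L makes the ratio L (2 * y) / L y vanish, far from its limit 1 *)
  have : F y = 0.
    by apply/eqP; rewrite eq_le fine_ge0// andbT Fx0 Fmono.
  rewrite FL// => /eqP; rewrite mulf_eq0 gt_eqF ?powR_gt0//= => /eqP Ly.
  by have := HM y My; rewrite /= Ly invr0 mulr0 ltxx.
have Ftrunc (x : R) : 0 <= x -> F x = F (Num.truncn x)%:R.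
  move=> x0; rewrite /F; congr (fine (P _)); apply/seteqP; split => w /=.
    by apply: le_lt_trans; rewrite truncn_le.
  by rewrite ltr_nat truncn_lt_nat.
have rvF : regularly_varying F alpha.
  move=> c c0.
  have H : c `^ (- alpha) * (L (c * x) / L x) @[x --> +oo] --> c `^ (- alpha) * 1.
    by apply: cvgM; [exact: cvg_cst|exact: hL].
  rewrite mulr1 in H; apply: cvg_trans H; apply: near_eq_cvg; near=> x.
  have x0 : 0 < x by near: x; exact: nbhs_pinfty_gt.
  rewrite !FL ?mulr_gt0// powRM ?(ltW c0) ?(ltW x0)// invfM.
  by rewrite mulrACA -[_ * x `^ _ * _]mulrA mulfV ?mulr1// gt_eqF ?powR_gt0.
have Wtail j : (0 < j)%N -> has_tail P F (W j).
  move=> j0; split; first exact: discrete_rv.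
  move=> x x0; rewrite -FE.
  exact: (parid_ident hG (i := j) (j := 1%N) j0 isT (A := [set n : nat | x < n%:R]) I).
have [x0 [q1 [q2 [x01 q1h q2h dbl]]]] :=
  regularly_varying_doubling Fpos rvF hs alpha1.
have [a Ha] := exists_tail_quantile Fpos Fmono Ftrunc rvF alpha0.
have s01 : 0 < s < 1 by rewrite s0.
have [D D0 HD] := degree_moment hG s01.
have [C C0 HC] := ratio_moment (parid_indep hG) Wtail Fpos Fmono s0 s1 Ha
  x01 q1h q2h dbl (fun j w => @parid_pos _ _ _ _ _ _ _ hG j w).
pose l := quantile_slow_part alpha a.
exists (D * C), l; split.
- exact: mulr_gt0.
- exact: (slowly_varying_quantile Fpos Fmono rvF Ha).
- by move=> x _; apply: (quantile_slow_part_gt0 alpha Ha).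
move=> t i t0 it; set k := maxn i 1.
have k0 : (0 < k)%N by rewrite leq_max orbT.
have kt : (k <= t)%N by rewrite geq_max it.
rewrite unlock.
apply: (le_trans (HD i t kt)).
apply: (@le_trans _ _ (D%:E * (C * ((a t%:R)%:R / (a k%:R)%:R) `^ s)%:E)%E).
  by apply: lee_wpmul2l; [rewrite lee_fin ltW|apply: HC; rewrite k0].
have ak0 : 0 < (a k%:R)%:R :> R.
  by have [ak _ _] := Ha k%:R (eqbRL (ltr0n _ _) k0); rewrite ltr0n.
have aE : ((a t%:R)%:R / (a k%:R)%:R : R) =
    (t%:R / k%:R) `^ alpha^-1 * (l t%:R / l i%:R).
  have -> : l i%:R = l k%:R.
    rewrite /l /quantile_slow_part (_ : Num.max i%:R 1 = Num.max k%:R 1 :> R)//.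
    rewrite /k; case: (i) => [|n]; last by rewrite (maxn_idPl _).
    by rewrite maxxx; apply/max_idPr; exact: ler01.
  rewrite [(a t%:R)%:R](quantile_slow_partE alpha) ?ler1n//.
  rewrite [(a k%:R)%:R](quantile_slow_partE alpha) ?ler1n// powR_div// -/l.
  by rewrite invfM mulrACA.
have rE : (t%:R / k%:R : R) `^ (s / alpha) * (l t%:R / l i%:R) `^ s =
    ((a t%:R)%:R / (a k%:R)%:R) `^ s.
  have l0 n : 0 <= l n by rewrite ltW// (quantile_slow_part_gt0 alpha Ha).
  rewrite aE [RHS]powRM ?powR_ge0 ?divr_ge0//.
  by rewrite -powRrM (mulrC s).
by rewrite -rE -EFinM lee_fin !mulrA.
Unshelve. all: by end_near. Qed.
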